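(* For every even integer $N\ge 4$ there exist a closed $N$-dimensional Riemannian manifold $(M,g)$ and a one-dimensional totally geodesic foliation $\mathcal F$ of $M$ such that $K_{\mathrm{mix}}>0$, the leaves of $\mathcal F$ are closed geodesics and form a smooth circle fibration (they are the fibers of a smooth fibration of $M$ with fiber $S^1$), and the metric $g$ is not bundle-like with respect to this fibration.
   Context: Closed means compact without boundary. For a foliation $\mathcal F$ of a Riemannian manifold $(M,g)$, a mixed plane is a 2-plane spanned by a vector tangent to $\mathcal F$ and a vector orthogonal to $\mathcal F$; $K_{\mathrm{mix}}$ denotes the sectional curvature of mixed planes, and $K_{\mathrm{mix}}>0$ means that it is positive on all mixed planes. A foliation is totally geodesic if its leaves are totally geodesic submanifolds. The metric $g$ is bundle-like with respect to a foliation (or a fibration, whose fibers are the leaves) if locally the foliation is given by the fibers of a Riemannian submersion; for a one-dimensional geodesic foliation with local unit tangent field $T$ this is equivalent to $(\mathcal L_Tg)(U,V)=0$ for all $U,V\perp T$. *)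

(* Defs.v *)
From Stdlib Require Import Relations.
From mathcomp Require Import all_boot all_order all_algebra.
From mathcomp Require Import all_classical all_reals all_analysis.

Set Implicit Arguments.
Unset Strict Implicit.
Unset Printing Implicit Defensive.

Import Order.TTheory GRing.Theory Num.Theory.
Import numFieldNormedType.Exports.

Local Open Scope classical_set_scope.
Local Open Scope ring_scope.

Section SmoothFunctions.
Context {R : realType} {n : nat}.
Implicit Types (U : set 'rV[R]_n) (f : 'rV[R]_n -> R).

Definition partial (i : 'I_n) f : 'rV[R]_n -> R := 'D_(delta_mx 0 i) f.

(* Only used with U open, so that pointwise continuity and differentiability
   do not see the values of f outside U. *)
Fixpoint Ck (k : nat) U f : Prop :=
  match k with
  | 0%N => forall x, U x -> {for x, continuous f}
  | k'.+1 => (forall x, U x -> differentiable f x) /\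
             (forall i, Ck k' U (partial i f))
  end.

Definition smooth_on U f : Prop := forall k, Ck k U f.

Definition smooth_vec_on m U (F : 'rV[R]_n -> 'rV[R]_m) : Prop :=
  forall j, smooth_on U (fun x => F x 0 j).

End SmoothFunctions.

(* cfun and cinv are total functions; only their restrictions
   cdom -> ccod and ccod -> cdom are meaningful. *)
Record chart (R : realType) (n : nat) (M : topologicalType) := Chart {
  cdom : set M;
  ccod : set 'rV[R]_n;
  cfun : M -> 'rV[R]_n;
  cinv : 'rV[R]_n -> M;
  cdom_open : open cdom;
  ccod_open : open ccod;
  cfun_ccod : forall p, cdom p -> ccod (cfun p);
  cinv_cdom : forall x, ccod x -> cdom (cinv x);
  cfunK : forall p, cdom p -> cinv (cfun p) = p;
  cinvK : forall x, ccod x -> cfun (cinv x) = x;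
  cfun_continuous : forall p, cdom p -> {for p, continuous cfun};
  cinv_continuous : forall x, ccod x -> {for x, continuous cinv}
}.

Section Transition.
Context {R : realType} {n : nat} {M : topologicalType}.
Implicit Types c d : chart R n M.

Definition overlap c d : set 'rV[R]_n := ccod c `&` cinv c @^-1` cdom d.

Definition transition c d : 'rV[R]_n -> 'rV[R]_n := cfun d \o cinv c.

Definition compatible c d : Prop :=
  smooth_vec_on (overlap c d) (transition c d) /\
  smooth_vec_on (overlap d c) (transition d c).

End Transition.

(* Charts take values in open sets of R^n, so there is no boundary.  The atlas
   need not be maximal. *)
Record smooth_manifold (R : realType) (n : nat) := SmoothManifold {
  msort :> topologicalType;
  atlas : set (chart R n msort);
  manifold_hausdorff : hausdorff_space msort;
  manifold_second_countable : @second_countable msort;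
  atlas_cover : forall p : msort, exists2 c, atlas c & cdom c p;
  atlas_compatible : forall c d, atlas c -> atlas d -> compatible c d
}.

Definition closed_manifold (R : realType) (n : nat) (M : smooth_manifold R n) :
  Prop := compact [set: M].

Section SmoothMaps.
Context {R : realType} {m n : nat}.
Variables (M : smooth_manifold R m) (P : smooth_manifold R n).

Definition smooth_fun_on (U : set M) (f : M -> R) : Prop :=
  forall c, atlas c -> smooth_on (ccod c `&` cinv c @^-1` U) (f \o cinv c).

Definition local_expr (f : M -> P) (c : chart R m M) (d : chart R n P) :
  'rV[R]_m -> 'rV[R]_n := cfun d \o f \o cinv c.

Definition local_dom (U : set M) (f : M -> P) (c : chart R m M)
    (d : chart R n P) : set 'rV[R]_m :=
  ccod c `&` cinv c @^-1` (U `&` f @^-1` cdom d).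

Definition smooth_map_on (U : set M) (f : M -> P) : Prop :=
  (forall p, U p -> {for p, continuous f}) /\
  (forall c d, atlas c -> atlas d ->
     smooth_vec_on (local_dom U f c d) (local_expr f c d)).

(* Smoothness of Phi on the open subset V x R of the product manifold M x R,
   in the coordinates row_mx x t of the product charts. *)
Definition smooth_family_on (V : set M) (Phi : M -> R -> P) : Prop :=
  (forall b t, V b ->
     {for (b, t), continuous (fun q : M * R => Phi q.1 q.2)}) /\
  (forall c d, atlas c -> atlas d ->
     let Psi (z : 'rV[R]_(m + 1)) := Phi (cinv c (lsubmx z)) (rsubmx z 0 0) in
     smooth_vec_on
       [set z | [/\ ccod c (lsubmx z), V (cinv c (lsubmx z)) & cdom d (Psi z)]]
       (cfun d \o Psi)).

End SmoothMaps.

(* The circle is the unit circle of R^2, with the smooth structure for which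
   t |-> (cos t, sin t) is a smooth covering.  A diffeomorphism
   pi^-1(V) -> V x S^1 over V is y |-> (pi y, (u y, w y)); its inverse is given
   by its composite Phi with id x (cos, sin) : V x R -> V x S^1, and it is
   smooth exactly when Phi is. *)
Definition circle_trivialization (R : realType) (m n : nat)
    (M : smooth_manifold R m) (B : smooth_manifold R n) (pi : M -> B)
    (V : set B) : Prop :=
  exists (u w : M -> R) (Phi : B -> R -> M),
    [/\ smooth_fun_on (pi @^-1` V) u,
        smooth_fun_on (pi @^-1` V) w,
        smooth_family_on V Phi,
        (forall b t, V b ->
           [/\ pi (Phi b t) = b, u (Phi b t) = cos t & w (Phi b t) = sin t]) &
        (forall y, V (pi y) ->
           u y ^+ 2 + w y ^+ 2 = 1 /\
           (forall t, u y = cos t -> w y = sin t -> Phi (pi y) t = y))].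

Definition circle_fibration (R : realType) (m n : nat)
    (M : smooth_manifold R m) (B : smooth_manifold R n) (pi : M -> B) : Prop :=
  [/\ smooth_map_on [set: M] pi,
      (forall b, exists p, pi p = b) &
      (forall b, exists V : set B,
         [/\ open V, V b & circle_trivialization pi V])].

Section LocalGeometry.
Context {R : realType} {n : nat}.
Variable G : 'rV[R]_n -> 'M[R]_n.
Implicit Types x v w z : 'rV[R]_n.

Definition inner x v w : R := (v *m G x *m w^T) 0 0.

(* christoffel k i j is Gamma^k_ij. *)
Definition christoffel (k i j : 'I_n) x : R :=
  2^-1 * \sum_l invmx (G x) k l *
    (partial i (fun y => G y j l) x + partial j (fun y => G y i l) x
     - partial l (fun y => G y i j) x).

Definition cov_deriv (X Y : 'rV[R]_n -> 'rV[R]_n) x : 'rV[R]_n :=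
  \row_k (\sum_i X x 0 i * partial i (fun y => Y y 0 k) x
          + \sum_i \sum_j christoffel k i j x * X x 0 i * Y x 0 j).

(* curvature x v w z is R(v, w) z, for
   R(X, Y) Z = D_X D_Y Z - D_Y D_X Z - D_[X, Y] Z. *)
Definition curvature x v w z : 'rV[R]_n :=
  \row_l \sum_i \sum_j \sum_k v 0 i * w 0 j * z 0 k *
    (partial i (christoffel l j k) x - partial j (christoffel l i k) x
     + \sum_m (christoffel m j k x * christoffel l i m x
               - christoffel m i k x * christoffel l j m x)).

Definition sectional_curvature x v w : R :=
  inner x (curvature x v w w) v /
  (inner x v v * inner x w w - inner x v w ^+ 2).

End LocalGeometry.

(* A metric is given by its components in the charts of the atlas.  Tangent
   vectors are row vectors of components, so that a change of charts acts on
   them by right multiplication with the Jacobian matrix 'J. *)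
Record riemannian_metric (R : realType) (n : nat) (M : smooth_manifold R n) :=
  RiemannianMetric {
  metric_coef :> chart R n M -> 'rV[R]_n -> 'M[R]_n;
  metric_smooth : forall c, atlas c ->
    forall i j, smooth_on (ccod c) (fun x => metric_coef c x i j);
  metric_sym : forall c, atlas c -> forall x, ccod c x ->
    (metric_coef c x)^T = metric_coef c x;
  metric_pos : forall c, atlas c -> forall x, ccod c x ->
    forall v, v != 0 -> 0 < inner (metric_coef c) x v v;
  metric_change : forall c d, atlas c -> atlas d ->
    forall x, overlap c d x ->
    metric_coef c x =
      jacobian (transition c d) x *m metric_coef d (transition c d x) *m
      (jacobian (transition c d) x)^T
}.

(* A p-dimensional foliation, given by a cover by foliated charts onto open
   boxes.  The plaques are the slices on which the coordinates of index >= p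
   are constant; the last condition says that changes of foliated charts
   preserve the distribution R^p x 0, hence locally map plaques to plaques. *)
Record foliation (R : realType) (n : nat) (M : smooth_manifold R n) (p : nat) :=
  Foliation {
  fatlas : set (chart R n M);
  fatlas_smooth : forall phi c, fatlas phi -> atlas c -> compatible phi c;
  fatlas_cover : forall q : M, exists2 phi, fatlas phi & cdom phi q;
  fatlas_box : forall phi, fatlas phi -> exists a b : 'rV[R]_n,
    ccod phi = [set x | forall i, a 0 i < x 0 i < b 0 i];
  fatlas_change : forall phi psi, fatlas phi -> fatlas psi ->
    forall x, overlap phi psi x -> forall i j : 'I_n, (i < p <= j)%N ->
    jacobian (transition phi psi) x i j = 0
}.

Section FoliationTheory.
Context {R : realType} {n p : nat} {M : smooth_manifold R n}.
Variable F : foliation M p.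

Definition same_plaque (y z : M) : Prop :=
  exists2 phi, fatlas F phi &
    [/\ cdom phi y, cdom phi z &
        forall j : 'I_n, (p <= j)%N -> cfun phi y 0 j = cfun phi z 0 j].

(* Leaves are the classes for the equivalence relation generated by the
   plaques. *)
Definition leaf (y : M) : set M :=
  [set z | clos_refl_sym_trans M same_plaque y z].

(* v, a vector of components in the chart c, is tangent to F at cinv c x. *)
Definition tangent (c : chart R n M) (x v : 'rV[R]_n) : Prop :=
  exists2 phi, fatlas F phi & cdom phi (cinv c x) /\
    forall j : 'I_n, (p <= j)%N ->
      (v *m jacobian (transition c phi) x) 0 j = 0.

Variable g : riemannian_metric M.

Definition normal (c : chart R n M) (x v : 'rV[R]_n) : Prop :=
  forall w, tangent c x w -> inner (g c) x v w = 0.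

(* The second fundamental form of the leaves vanishes: the covariant
   derivative of tangent fields has no normal component. *)
Definition totally_geodesic : Prop :=
  forall c (V : set 'rV[R]_n) (X Y : 'rV[R]_n -> 'rV[R]_n),
    atlas c -> open V -> V `<=` ccod c ->
    smooth_vec_on V X -> smooth_vec_on V Y ->
    (forall x, V x -> tangent c x (X x) /\ tangent c x (Y x)) ->
    forall x, V x -> tangent c x (cov_deriv (g c) X Y x).

Definition Kmix_pos : Prop :=
  forall c x v w, atlas c -> ccod c x ->
    tangent c x v -> normal c x w -> v != 0 -> w != 0 ->
    0 < sectional_curvature (g c) x v w.

End FoliationTheory.

Section Geodesics.
Context {R : realType} {n : nat} {M : smooth_manifold R n}.
Variable g : riemannian_metric M.

Definition curve_coord (c : chart R n M) (gamma : R -> M) (k : 'I_n) (t : R) : R :=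
  cfun c (gamma t) 0 k.

Definition smooth_curve (gamma : R -> M) : Prop :=
  continuous gamma /\
  forall c t, atlas c -> cdom c (gamma t) ->
    forall k r, derivable (derive1n r (curve_coord c gamma k)) t 1.

Definition geodesic (gamma : R -> M) : Prop :=
  smooth_curve gamma /\
  forall c t, atlas c -> cdom c (gamma t) -> forall k,
    derive1n 2 (curve_coord c gamma k) t
    + \sum_i \sum_j christoffel (g c) k i j (cfun c (gamma t)) *
        derive1 (curve_coord c gamma i) t * derive1 (curve_coord c gamma j) t = 0.

Definition closed_geodesic (L : set M) : Prop :=
  exists (gamma : R -> M) (T : R),
    [/\ geodesic gamma, 0 < T, (forall t, gamma (t + T) = gamma t),
        (exists t, gamma t <> gamma 0) & L = range gamma].

End Geodesics.

Definition riemannian_submersion_on (R : realType) (m n : nat)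
    (M : smooth_manifold R m) (Q : smooth_manifold R n)
    (g : riemannian_metric M) (h : riemannian_metric Q)
    (U : set M) (f : M -> Q) : Prop :=
  smooth_map_on U f /\
  forall c d x, atlas c -> atlas d -> local_dom U f c d x ->
    let J := jacobian (local_expr f c d) x in
    let horizontal v := forall w, w *m J = 0 -> inner (g c) x v w = 0 in
    row_full J /\
    forall v w, horizontal v -> horizontal w ->
      inner (h d) (local_expr f c d x) (v *m J) (w *m J) = inner (g c) x v w.

(* The leaves of the restriction of F to U are the connected components of the
   intersections of U with the leaves of F. *)
Definition bundle_like (R : realType) (n p : nat) (M : smooth_manifold R n)
    (g : riemannian_metric M) (F : foliation M p) : Prop :=
  forall q : M, exists (U : set M) (Q : smooth_manifold R (n - p))
      (h : riemannian_metric Q) (f : M -> Q),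
    [/\ open U, U q, riemannian_submersion_on g h U f &
        forall y, U y ->
          U `&` f @^-1` [set f y] = connected_component (U `&` leaf F y) y].

(* Main.v *)
(** Let [M] be the torus [T^(2m+2)] with coordinates [t, u_1, ..., u_m,
    x_0, ..., x_m], foliated by the [t]-circles.  Fix an immersion [f] of the
    [u]-torus in [R^(m+1)] as a hypersurface, with orthogonal partial
    derivatives [r_i tau_i] and unit normal [nu], normalised by [r_m = 2], and put
      [g = (dt + f . dx)^2 + |du|^2 + |dx|^2 + (nu . dx) (cos t du_m - sin t tau_m . dx)].
    The unit field [T = d/dt] is geodesic because [g(T, .) = dt + f . dx] does not
    depend on [t].  The curvature [g(R(T, w) w, T)] is
      [- 1/2 (T T g)(w, w) + |(1/2) (T g + d(f . dx))(w, .)|^2],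
    and on [w] orthogonal to [T] it equals
      [1/16 nu(w)^2 + q(w)^2 + 13/12 q'(w)^2 + |z(w)|^2 / 4]
    where [q = cos t du_m - sin t tau_m], [q' = dq/dt], and [z(w)] has the
    components [r_i du_i(w)] and [r_i tau_i(w)] for [i < m].  The coefficient
    [r_m = 2] is the one that cancels the cross term [nu(w) q(w)].  The
    perturbation of size [1/2] by [nu q] is what makes the curvature positive
    in the direction [nu], which is the kernel of [d(f . dx)]; it also makes the
    squared length [2 + cos t] of a horizontal lift of [nu + du_m] vary along the fibres, so
    that no local quotient can be a Riemannian submersion. *)
From Stdlib Require Import Relations.
Require Import Defs.
From mathcomp Require Import all_boot all_order all_algebra.
From mathcomp Require Import all_classical all_reals all_analysis.
From mathcomp Require Import ring lra zify.

Set Implicit Arguments.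
Unset Strict Implicit.
Unset Printing Implicit Defensive.

Import Order.TTheory GRing.Theory Num.Theory.
Import numFieldNormedType.Exports.

Local Open Scope classical_set_scope.
Local Open Scope ring_scope.

(** * Elementary functions and partial derivatives *)

Section NearEquality.
Context {R : realType} {V W : normedModType R}.
Implicit Types (f g : V -> W) (x : V).

(** For a bundle-like metric [T g] vanishes on the normal space, and the mixed curvature is the
    squared norm of half of [d(g(T, .))(w, .)]. The normal space has odd dimension [N - 1], so this
    2-form has a kernel there and [K_mix > 0] is impossible. The metric must therefore vary along
    the leaves, and the perturbation pairs the kernel [nu] with a unit vector [q] turning at unit
    speed. As [q'' = - q], the term in [T T g] contributes [nu q / 2] and the square contributes
    [- r_m nu q / 4]; both are linear in the size of the perturbation, so the balance [r_m = 2] is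
    independent of that size. A sphere in spherical coordinates would not serve as hypersurface when
    [m >= 2], since its partial derivatives vanish at the poles. But the sphere points of all
    dimensions have derivatives along [u_i] that are multiples of one vector [tau_i], so any
    combination of them keeps the frame and the normal, and weights can be chosen that keep every
    [r_i] away from 0. All coefficients are trigonometric expressions, including those of the
    inverse metric, which is written down explicitly. *)

Lemma near_near (T : topologicalType) (P : T -> Prop) (x : T) :
  (\near x, P x) -> \near x, \near x, P x.
Proof. by move=> /nbhs_interior. Qed.

(** Chart maps and lifts are total functions that agree with explicit formulas only near a point.
    The differential is transferred along such a local equality through uniqueness of the
    first-order expansion. *)
Lemma near_eq_littleo f g x : (\near x, f x = g x) -> differentiable g x ->
  f \o shift x = cst (f x) + 'd g x +o_ 0 id.
Proof.
move=> fg dg; have fgx : f x = g x by exact: nbhs_singleton fg.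
rewrite fgx; have /eqaddoP dgo := diff_locally dg.
apply/eqaddoP => e e0; have dgoe := dgo e e0.
have fgs : \forall h \near 0, f (x + h) = g (x + h) by move/nbhs0P: fg.
apply: filterS2 fgs dgoe => h fgh.
by rewrite !fctE /= [h + x]addrC fgh.
Qed.

Lemma near_eq_diff f g x : (\near x, f x = g x) -> differentiable g x ->
  'd f x = 'd g x :> (_ -> _).
Proof.
by move=> fg dg; apply: diff_unique; [exact: diff_continuous|exact: near_eq_littleo].
Qed.

Lemma near_eq_differentiable f g x :
  (\near x, f x = g x) -> differentiable g x -> differentiable f x.
Proof.
move=> fg dg; apply/diff_locallyP; rewrite (near_eq_diff fg dg).
by split; [exact: diff_continuous|exact: near_eq_littleo].
Qed.

End NearEquality.

Section PartialDerivatives.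
Context {R : realType} {n : nat}.
Implicit Types (f g : 'rV[R]_n -> R) (x : 'rV[R]_n) (i k : 'I_n) (c : R).

Lemma partial_near f g x i :
  (\near x, f x = g x) -> partial i f x = partial i g x.
Proof. exact: near_eq_derive. Qed.

Lemma partial_cst c x i : partial i (fun=> c) x = 0.
Proof. exact: derive_cst. Qed.

Lemma partialD f g x i : differentiable f x -> differentiable g x ->
  partial i (fun y => f y + g y) x = partial i f x + partial i g x.
Proof. by move=> df dg; apply: deriveD; apply: diff_derivable. Qed.

Lemma partialM f g x i : differentiable f x -> differentiable g x ->
  partial i (fun y => f y * g y) x = f x * partial i g x + g x * partial i f x.
Proof. by move=> df dg; apply: deriveM; apply: diff_derivable. Qed.

Lemma partialN f x i : differentiable f x ->
  partial i (fun y => - f y) x = - partial i f x.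
Proof. by move=> df; apply: deriveN; apply: diff_derivable. Qed.

Lemma partialZ c f x i : differentiable f x ->
  partial i (fun y => c * f y) x = c * partial i f x.
Proof.
move=> df; rewrite partialM //.
by rewrite partial_cst mulr0 addr0.
Qed.

Lemma partial_comp (h : R -> R) f x i : differentiable f x ->
  derivable h (f x) 1 ->
  partial i (fun y => h (f y)) x = partial i f x * derive1 h (f x).
Proof.
move=> df dh; rewrite /partial -[fun y => _]/(h \o f).
rewrite !deriveE //; last by apply: differentiable_comp => //; apply/derivable1_diffP.
rewrite diff_comp //; last by apply/derivable1_diffP.
by rewrite /= deriv1E.
Qed.

Lemma derive1_sin (a : R) : derive1 (@sin R) a = cos a.
Proof. by rewrite derive1E derive_val. Qed.

Lemma derive1_cos (a : R) : derive1 (@cos R) a = - sin a.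
Proof. by rewrite derive1E derive_val. Qed.

Lemma partial_sin f x i : differentiable f x ->
  partial i (fun y => sin (f y)) x = cos (f x) * partial i f x.
Proof.
by move=> df; rewrite partial_comp ?derive1_sin 1?mulrC //; exact: derivable_sin.
Qed.

Lemma partial_cos f x i : differentiable f x ->
  partial i (fun y => cos (f y)) x = - (sin (f x) * partial i f x).
Proof.
move=> df; rewrite partial_comp ?derive1_cos //.
by rewrite mulrN mulrC.
Qed.

Lemma partial_coord x i k : partial i (fun y => y 0 k) x = (i == k)%:R.
Proof.
rewrite /partial deriveE; last exact: differentiable_coord.
have @f : {linear 'rV[R]_n -> R}.
  by exists (fun y : 'rV[R]_n => y 0 k); do 2![eexists]; do ?[constructor];
     rewrite ?mxE // => ? *; rewrite ?mxE //; move=> ?; rewrite !mxE.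
rewrite (_ : (fun _ => _) = f) // diff_lin; last exact: coord_continuous.
by rewrite /= mxE eqxx /= eq_sym.
Qed.

(** A class closed under partial derivatives, so that differentiability of its members already
    yields smoothness of every order. It has no division, hence the explicit inverse of the metric
    further on. *)
Inductive elementary : ('rV[R]_n -> R) -> Prop :=
| elementary_cst c : elementary (fun=> c)
| elementary_coord k : elementary (fun x => x 0 k)
| elementaryD f g : elementary f -> elementary g ->
    elementary (fun x => f x + g x)
| elementaryM f g : elementary f -> elementary g ->
    elementary (fun x => f x * g x)
| elementary_sin f : elementary f -> elementary (fun x => sin (f x))
| elementary_cos f : elementary f -> elementary (fun x => cos (f x)).

Lemma elementary_differentiable f x : elementary f -> differentiable f x.
Proof.
elim=> {f} [c|k|f g _ df _ dg|f g _ df _ dg|f _ df|f _ df].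
- exact: differentiable_cst.
- exact: differentiable_coord.
- exact: differentiableD.
- exact: differentiableM.
- by apply: (differentiable_comp df); apply/derivable1_diffP/derivable_sin.
- by apply: (differentiable_comp df); apply/derivable1_diffP/derivable_cos.
Qed.

Lemma elementaryN f : elementary f -> elementary (fun x => - f x).
Proof.
move=> ef; rewrite (_ : (fun x => _) = (fun x => -1 * f x)).
  by apply: elementaryM => //; apply: elementary_cst.
by apply/funext => x; rewrite mulN1r.
Qed.

Lemma elementary_partial f i : elementary f -> elementary (partial i f).
Proof.
elim=> {f} [c|k|f g ef e1 eg e2|f g ef e1 eg e2|f ef e1|f ef e1].
- by rewrite (_ : partial i _ = fun=> 0); [exact: elementary_cst|
    apply/funext => x; rewrite partial_cst].
- by rewrite (_ : partial i _ = fun=> (i == k)%:R); [exact: elementary_cst|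
    apply/funext => x; rewrite partial_coord].
- rewrite (_ : partial i _ = fun x => partial i f x + partial i g x).
    exact: elementaryD.
  by apply/funext => x; rewrite partialD //; apply: elementary_differentiable.
- rewrite (_ : partial i _ =
    fun x => f x * partial i g x + g x * partial i f x).
    by apply: elementaryD; apply: elementaryM.
  by apply/funext => x; rewrite partialM //; apply: elementary_differentiable.
- rewrite (_ : partial i _ = fun x => cos (f x) * partial i f x).
    by apply: elementaryM => //; apply: elementary_cos.
  by apply/funext => x; rewrite partial_sin //; apply: elementary_differentiable.
- rewrite (_ : partial i _ = fun x => - (sin (f x) * partial i f x)).
    by apply/elementaryN/elementaryM => //; apply: elementary_sin.
  by apply/funext => x; rewrite partial_cos //; apply: elementary_differentiable.
Qed.

Lemma elementary_sum (I : Type) (r : seq I) (P : pred I) (F : I -> 'rV[R]_n -> R) :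
  (forall j, elementary (F j)) -> elementary (fun x => \sum_(j <- r | P j) F j x).
Proof.
move=> eF; elim: r => [|j r IH].
  rewrite (_ : (fun _ => _) = fun=> 0); first exact: elementary_cst.
  by apply/funext => x; rewrite big_nil.
rewrite (_ : (fun _ => _) =
  fun x => (if P j then F j x else 0) + \sum_(k <- r | P k) F k x).
  by apply: elementaryD => //; case: (P j) => //; exact: elementary_cst.
by apply/funext => x; rewrite big_cons; case: (P j) => //; rewrite add0r.
Qed.

Lemma partial_sum (I : Type) (r : seq I) (F : I -> 'rV[R]_n -> R) x i :
  (forall j, elementary (F j)) ->
  partial i (fun y => \sum_(j <- r) F j y) x = \sum_(j <- r) partial i (F j) x.
Proof.
move=> eF; elim: r => [|j r IH].
  rewrite big_nil (_ : (fun _ => _) = fun=> 0) ?partial_cst //.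
  by apply/funext => y; rewrite big_nil.
rewrite big_cons -IH -partialD; first by congr (partial i _ x);
  apply/funext => y; rewrite big_cons.
- exact: elementary_differentiable.
- by apply: elementary_differentiable; apply: elementary_sum.
Qed.

Lemma elementary_Ck r U f : elementary f -> Ck r U f.
Proof.
elim: r f => [|r IH] f ef /=.
  by move=> x _; apply/differentiable_continuous/elementary_differentiable.
split; first by move=> x _; apply: elementary_differentiable.
by move=> i; apply/IH/elementary_partial.
Qed.

Lemma elementary_smooth U f : elementary f -> smooth_on U f.
Proof. by move=> ef k; apply: elementary_Ck. Qed.

(** The elementary function may change from point to point: local equality passes to the partial
    derivatives on a neighbourhood, which is what the induction on the order consumes. *)
Lemma near_elementary_smooth U f :
  (forall x, U x -> exists2 g, elementary g & \near x, f x = g x) ->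
  smooth_on U f.
Proof.
move=> Uf r; elim: r f Uf => [|r IH] f Uf /=.
  move=> x /Uf[g eg fg]; apply/differentiable_continuous/(near_eq_differentiable fg).
  exact: elementary_differentiable.
split=> [x /Uf[g eg fg]|i].
  exact/(near_eq_differentiable fg)/elementary_differentiable.
apply: IH => x /Uf[g eg fg]; exists (partial i g).
  exact: elementary_partial.
by apply: filterS (near_near fg) => y; exact: partial_near.
Qed.

End PartialDerivatives.

(** * The torus *)

Section Boxes.
Context {R : realType} {n : nat}.
Implicit Types (x y a b c : 'rV[R]_n) (A : set 'rV[R]_n).

Definition box a b : set 'rV[R]_n := [set x | forall i, a 0 i < x 0 i < b 0 i].

Lemma nbhs_rowP x A :
  nbhs x A <-> exists2 e : R, 0 < e &
    forall y, (forall i, `|x 0 i - y 0 i| < e) -> A y.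
Proof.
split=> [/nbhs_ballP[e e0 eA]|[e e0 eA]].
  exists e => // y xy; apply: eA; split=> // i j.
  by rewrite [i]ord1; exact: xy.
by apply/nbhs_ballP; exists e => // y [_ xy]; apply: eA => i; exact: xy.
Qed.

Lemma open_box a b : open (box a b).
Proof.
rewrite openE => x xab; apply/nbhs_rowP.
pose d i := Num.min (x 0 i - a 0 i) (b 0 i - x 0 i).
have d0 i : 0 < d i by have /andP[? ?] := xab i; rewrite lt_min !subr_gt0; apply/andP.
exists (\big[Num.min/1]_i d i).
  by elim/big_ind: _ => // u v u0 v0; rewrite lt_min u0 v0.
move=> y xy i; have := lt_le_trans (xy i) (bigmin_le_cond 1 d (erefl : xpredT i)).
rewrite /d lt_min !ltr_norml => /andP[/andP[? ?] /andP[? ?]].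
by apply/andP; split; lra.
Qed.

Lemma row_second_countable : @second_countable 'rV[R]_n.
Proof.
pose Q (c : {ffun 'I_n -> rat * rat}) : set 'rV[R]_n :=
  box (\row_i ratr (c i).1) (\row_i ratr (c i).2).
exists (range Q); first exact: (sub_countable (card_image_le _ _)).
split=> [_ [c _ <-]|x A /nbhs_rowP[e e0 eA]]; first exact: open_box.
have ratP i : exists c : rat * rat,
    x 0 i - e < ratr c.1 < x 0 i /\ x 0 i < ratr c.2 < x 0 i + e.
  have [c1 h1] : exists q : rat, ratr q \in `]x 0 i - e, x 0 i[.
    by apply: rat_in_itvoo; rewrite gtrBl.
  have [c2 h2] : exists q : rat, ratr q \in `]x 0 i, x 0 i + e[.
    by apply: rat_in_itvoo; rewrite ltrDl.
  by exists (c1, c2); move: h1 h2; rewrite !in_itv /=.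
have [c cP] := choice ratP.
exists (Q [ffun i => c i]) => [|y yQ].
  split; first by exists [ffun i => c i].
  move=> i; rewrite !mxE ffunE; have [/andP[_ ->] /andP[-> _]] := cP i.
  by [].
apply: eA => i; have := yQ i; rewrite !mxE ffunE.
have [/andP[? ?] /andP[? ?]] := cP i => /andP[? ?].
by rewrite ltr_norml; apply/andP; split; lra.
Qed.

Lemma continuous_rowP m (T : topologicalType) (f : T -> 'rV[R]_m) p :
  {for p, continuous f} <-> forall j, {for p, continuous (fun q => f q 0 j)}.
Proof.
split=> [cf j|cf A].
  by apply: (@continuous_comp _ _ _ f (fun y : 'rV[R]_m => y 0 j)) => //;
     exact: coord_continuous.
rewrite /= => /nbhs_ballP[e e0 eA].
have : \forall q \near p, forall j, `|f p 0 j - f q 0 j| < e.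
  apply: filter_forall => j; have := cf j; move/cvgrPdist_lt; exact.
by apply: filterS => q pq; apply: eA; split=> // i j; rewrite [i]ord1; exact: pq.
Qed.

Lemma elementary_row_continuous m (f : 'rV[R]_n -> 'rV[R]_m) :
  (forall j, elementary (fun x => f x 0 j)) -> continuous f.
Proof.
move=> ef x; apply/continuous_rowP => j.
exact/differentiable_continuous/elementary_differentiable/ef.
Qed.

Lemma elementary_translate c j : elementary (fun x : 'rV[R]_n => (x + c) 0 j).
Proof.
rewrite (_ : (fun x => _) = fun x : 'rV[R]_n => x 0 j + c 0 j).
  by apply: elementaryD; [exact: elementary_coord|exact: elementary_cst].
by apply/funext => x; rewrite mxE.
Qed.

Lemma translate_continuous c : continuous (fun x : 'rV[R]_n => x + c).
Proof. by apply: elementary_row_continuous => j; exact: elementary_translate. Qed.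

End Boxes.

Section Torus.
Context {R : realType} (n : nat).
Implicit Types (x y a b : 'rV[R]_n) (k : 'I_n -> int).

Definition period k : 'rV[R]_n := \row_i ((k i)%:~R * (pi *+ 2)).

Lemma period0 : period (fun=> 0) = 0.
Proof. by apply/rowP => i; rewrite !mxE mul0r. Qed.

Lemma periodN k : period (fun i => - k i) = - period k.
Proof. by apply/rowP => i; rewrite !mxE mulrNz mulNr. Qed.

Lemma periodD k l : period (fun i => k i + l i) = period k + period l.
Proof. by apply/rowP => i; rewrite !mxE intrD mulrDl. Qed.

Definition torus_rel x y : bool := `[< exists k, y = x + period k >].

Lemma torus_rel_equiv : equiv_class_of torus_rel.
Proof.
split=> [x|x y|y x z].
- by apply/asboolP; exists (fun=> 0); rewrite period0 addr0.
- by apply/asboolP/asboolP => -[k ->]; exists (fun i => - k i);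
    rewrite periodN addrK.
- move=> /asboolP[k ->] /asboolP[l ->]; apply/asboolP.
  by exists (fun i => k i + l i); rewrite periodD addrA.
Qed.

Canonical torus_equiv := EquivRelPack torus_rel_equiv.

Definition torus_space : topologicalType :=
  quotient_topology {eq_quot torus_equiv}%qT.

Definition proj x : torus_space := (\pi_({eq_quot torus_equiv}) x)%qT.

Lemma proj_eqP x y : proj x = proj y <-> exists k, y = x + period k.
Proof.
split=> [/eqquotP/asboolP //|xy].
by apply/eqquotP/asboolP.
Qed.

Lemma projDperiod x k : proj (x + period k) = proj x.
Proof. by apply/esym/proj_eqP; exists k. Qed.

Lemma proj_surj (p : torus_space) : exists x, proj x = p.
Proof. by exists (repr p); rewrite /proj reprK. Qed.

Lemma proj_continuous : continuous proj.
Proof. exact: pi_continuous. Qed.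

Lemma proj_open (A : set 'rV[R]_n) : open A -> open (proj @` A).
Proof.
move=> oA; rewrite /open /= /quotient_open.
rewrite (_ : _ @^-1` _ = \bigcup_k [set x | A (x + period k)]).
  apply: bigcup_open => k _; rewrite (_ : [set x | _] = (+%R^~ (period k)) @^-1` A) //.
  by apply: open_comp => // x _; exact: translate_continuous.
apply/seteqP; split=> [x [y Ay /proj_eqP[k xE]]|x [k _ Ax]] /=.
  by exists (fun i => - k i) => //=; rewrite periodN xE addrK.
by exists (x + period k) => //; exact: projDperiod.
Qed.

(* The projection is an open map, so it creates the neighbourhoods of its
   image points. *)
Lemma nbhs_projP x (P : set torus_space) :
  nbhs (proj x) P <-> \forall y \near x, P (proj y).
Proof.
split=> [|xP]; first exact: proj_continuous.
have : nbhs x (interior [set y | P (proj y)]) by apply: nbhs_interior.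
move=> /nbhs_singleton xI.
exists (proj @` interior [set y | P (proj y)]); split.
- by apply: proj_open; exact: open_interior.
- by exists x.
- by move=> _ [y /interior_subset yP <-].
Qed.

Lemma proj_comp_continuous (T : topologicalType) (f : torus_space -> T) x :
  {for x, continuous (f \o proj)} -> {for proj x, continuous f}.
Proof. by move=> cf A /cf xA; apply/nbhs_projP. Qed.

Lemma torus_second_countable : @second_countable torus_space.
Proof.
have [B cB [oB nB]] := @row_second_countable R n.
exists [set proj @` A | A in B]; first exact: (sub_countable (card_image_le _ _)).
split=> [_ [A BA <-]|p C].
  by apply: proj_open; exact: oB.
have [x <-] := proj_surj p => /nbhs_projP /nB[A [BA Ax] AC].
exists (proj @` A); first by split; [exists A|exists x].
by move=> _ [y Ay <-]; exact: AC.
Qed.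

Lemma fract_period (t : R) : exists k : int, 0 <= t + k%:~R * (pi *+ 2) <= pi *+ 2.
Proof.
have p0 : 0 < pi *+ 2 :> R by rewrite pmulrn_lgt0 ?pi_gt0.
exists (- Num.floor (t / (pi *+ 2))); have /andP[h1 h2] := floor_itv (t / (pi *+ 2)).
move: h1 h2; rewrite ler_pdivlMr // ltr_pdivrMr // intrD mulrDl mul1r mulrNz mulNr.
by move=> h1 h2; apply/andP; split; lra.
Qed.

Lemma torus_compact : compact [set: torus_space].
Proof.
have -> : [set: torus_space] =
    proj @` [set x : 'rV[R]_n | forall i, `[0, pi *+ 2]%classic (x ord0 i)].
  apply/seteqP; split=> // p _; have [x <-] := proj_surj p.
  have [k kP] := choice (fun i => fract_period (x 0 i)).
  exists (x + period k); last exact: projDperiod.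
  by move=> i /=; rewrite in_itv /= !mxE.
apply: continuous_compact.
  by apply: continuous_subspaceT; exact: proj_continuous.
apply: (@rV_compact R n (fun=> `[0, pi *+ 2]%classic)) => _.
exact: segment_compact.
Qed.

Lemma cos_period (t : R) (k : int) : cos (t + k%:~R * (pi *+ 2)) = cos t.
Proof.
have cosP m s : cos (s + m%:R * (pi *+ 2)) = cos s :> R.
  by rewrite mulr_natl (periodicn (@cosD2pi R)).
case: k => m; rewrite ?NegzE ?mulrNz; first exact: cosP.
by rewrite -(cosP m.+1 (t + _)) mulNr subrK.
Qed.

Lemma sin_period (t : R) (k : int) : sin (t + k%:~R * (pi *+ 2)) = sin t.
Proof.
have sinP m s : sin (s + m%:R * (pi *+ 2)) = sin s :> R.
  by rewrite mulr_natl (periodicn (@sinD2pi R)).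
case: k => m; rewrite ?NegzE ?mulrNz; first exact: sinP.
by rewrite -(sinP m.+1 (t + _)) mulNr subrK.
Qed.

(** The difference, reduced to [d] in the closed interval from 0 to 2 pi, has cosine 1. Injectivity
    of cosine on [[0, pi]] settles the first half, the reflection [pi *+ 2 - d] the second;
    closedness leaves the two solutions 0 and 2 pi. *)
Lemma cos_sin_inj (s t : R) : cos s = cos t -> sin s = sin t ->
  exists k : int, t = s + k%:~R * (pi *+ 2).
Proof.
move=> cst sst; have [k] := fract_period (t - s).
set d := _ + _ => dP.
have cd : cos d = 1.
  rewrite /d cos_period cosB cst sst -!expr2; exact: cos2Dsin2.
have sd : sin d = 0.
  by rewrite /d sin_period sinB cst sst mulrC subrr.
suff /orP[/eqP d0|/eqP d0] : (d == 0) || (d == pi *+ 2).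
- by exists (- k); move: d0; rewrite /d mulrNz mulNr; lra.
- by exists (1 - k); move: d0; rewrite /d intrB mulrBl mul1r; lra.
have pi0 := @pi_gt0 R; move: dP => /andP[d0 d2].
have [dpi|dpi] := leP d pi.
  have : d = 0 by apply: cos_inj; rewrite ?in_itv /= ?lexx ?d0 ?dpi ?(ltW pi0) ?cos0.
  by move=> ->; rewrite eqxx.
have : pi *+ 2 - d = 0.
  apply: cos_inj; rewrite ?in_itv /= ?lexx ?(ltW pi0) //.
    by apply/andP; split; lra.
  by rewrite cosB cos2pi sin2pi mul0r addr0 mul1r cd cos0.
by move=> dE; apply/orP; right; apply/eqP; lra.
Qed.

(** Evaluated at the chosen representative; periodicity makes the choice irrelevant. These functions
    separate the points of the torus and later serve as fibre coordinates on the circle. *)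
Definition torus_cos (i : 'I_n) (p : torus_space) : R := cos (repr p 0 i).
Definition torus_sin (i : 'I_n) (p : torus_space) : R := sin (repr p 0 i).

Lemma torus_cosE i x : torus_cos i (proj x) = cos (x 0 i).
Proof.
rewrite /torus_cos; have : proj (repr (proj x)) = proj x by rewrite /proj reprK.
by move=> /proj_eqP[k xE]; rewrite [in RHS]xE !mxE cos_period.
Qed.

Lemma torus_sinE i x : torus_sin i (proj x) = sin (x 0 i).
Proof.
rewrite /torus_sin; have : proj (repr (proj x)) = proj x by rewrite /proj reprK.
by move=> /proj_eqP[k xE]; rewrite [in RHS]xE !mxE sin_period.
Qed.

Lemma torus_cos_continuous i : continuous (torus_cos i).
Proof.
move=> p; have [x <-] := proj_surj p; apply: proj_comp_continuous.
rewrite (_ : _ \o _ = fun y => cos (y 0 i)).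
  by apply/differentiable_continuous/elementary_differentiable;
    exact/elementary_cos/elementary_coord.
by apply/funext => y; rewrite /= torus_cosE.
Qed.

Lemma torus_sin_continuous i : continuous (torus_sin i).
Proof.
move=> p; have [x <-] := proj_surj p; apply: proj_comp_continuous.
rewrite (_ : _ \o _ = fun y => sin (y 0 i)).
  by apply/differentiable_continuous/elementary_differentiable;
    exact/elementary_sin/elementary_coord.
by apply/funext => y; rewrite /= torus_sinE.
Qed.

(** Two points whose neighbourhoods always meet have equal values under every continuous real
    function. Equal cosines and sines of all coordinates mean equality modulo periods. *)
Lemma torus_hausdorff : hausdorff_space torus_space.
Proof.
have clE (f : torus_space -> R) p q : continuous f -> cluster (nbhs p) q -> f p = f q.
  move=> cf pq; apply: (@Rhausdorff R) => A B /cf pA /cf qB.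
  by have [r [Ar Br]] := pq _ _ pA qB; exists (f r).
move=> p q pq; have [x xp] := proj_surj p; have [y yq] := proj_surj q.
rewrite -xp -yq in pq *; apply/proj_eqP.
have /choice[k kP] : forall i, exists k : int, y 0 i = x 0 i + k%:~R * (pi *+ 2).
  move=> i; apply: cos_sin_inj.
    by rewrite -!torus_cosE; apply: clE => //; exact: torus_cos_continuous.
  by rewrite -!torus_sinE; apply: clE => //; exact: torus_sin_continuous.
by exists k; apply/rowP => i; rewrite !mxE.
Qed.

End Torus.

(** * Charts, periodic metrics and coordinate foliations on the torus *)

Lemma jacobian_near_translate (R : realType) n (f : 'rV[R]_n -> 'rV[R]_n) x c :
  (\near x, f x = x + c) -> jacobian f x = 1%:M.
Proof.
move=> fc; have df : differentiable (fun y : 'rV[R]_n => y + c) x.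
  by apply: (@differentiableD _ _ _ idfun (cst c)).
have dv (v : 'rV[R]_n) : 'D_v (fun y : 'rV[R]_n => y + c) x = v.
  rewrite -[fun y => _]/(id + cst c) deriveD; last exact: derivable_cst.
    by rewrite derive_id derive_cst addr0.
  exact: derivable_id.
apply/row_matrixP => i; rewrite !rowE mul_rV_lin1 (near_eq_diff fc df) mulmx1.
by rewrite -[RHS]dv deriveE.
Qed.

Section TorusCharts.
Context {R : realType} (n : nat).
Implicit Types (x y a b : 'rV[R]_n) (k : 'I_n -> int).

(** The side 2 is shorter than the period 2 pi, which makes the projection injective on each cell;
    the bound [pi >= 2] suffices for this. *)
Definition cell a : set 'rV[R]_n := box (a - const_mx 1) (a + const_mx 1).

Lemma cellP a x : cell a x <-> forall i, `|x 0 i - a 0 i| < 1.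
Proof.
split=> ax i; have := ax i; rewrite !mxE ltr_norml => /andP[? ?];
  by apply/andP; split; lra.
Qed.

Lemma cell_center a : cell a a.
Proof. by apply/cellP => i; rewrite subrr normr0. Qed.

Lemma cell_inj a x y : cell a x -> cell a y -> proj x = proj y -> x = y.
Proof.
move=> /cellP ax /cellP ay /proj_eqP[k yE]; apply/rowP => i.
rewrite yE !mxE; suff -> : k i = 0 by rewrite mul0r addr0.
have := ax i; have := ay i; rewrite yE !mxE !ltr_norml => /andP[h1 h2] /andP[h3 h4].
have pi2 := @pi_ge2 R; have : `|(k i)%:~R : R| < 1.
  by rewrite ltr_norml; apply/andP; split; nra.
by rewrite -intr_norm -[1]/(1%:~R) ltr_int; lia.
Qed.

Definition cell_lift a (p : @torus_space R n) : 'rV[R]_n :=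
  xget 0 [set x | cell a x /\ proj x = p].

Lemma cell_liftP a p : (@proj R n @` cell a) p -> cell a (cell_lift a p) /\ proj (cell_lift a p) = p.
Proof. by move=> [x ax xp]; exact: (@xgetI _ 0 [set x | cell a x /\ proj x = p] x (conj ax xp)). Qed.

Lemma cell_liftK a x : cell a x -> cell_lift a (proj x) = x.
Proof.
move=> ax; have [ay yx] := @cell_liftP a (proj x) (ex_intro2 _ _ x ax erefl).
exact: cell_inj ay ax yx.
Qed.

(** The source of all local computations on the torus: near a given point the lift is translation by
    one fixed period, so changes of charts are locally translations with identity Jacobian. *)
Lemma cell_lift_near a x : (@proj R n @` cell a) (proj x) ->
  exists k, cell a (x + period k) /\
    \forall y \near x, cell a (y + period k) /\ cell_lift a (proj y) = y + period k.
Proof.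
move=> [z az /esym /proj_eqP[k zE]]; exists k; rewrite -zE; split=> //.
have : \forall y \near x, cell a (y + period k).
  apply: (@translate_continuous R n (@period R n k) x).
  by apply: open_nbhs_nbhs; rewrite -zE; split=> //; exact: open_box.
apply: filterS => y ay; split=> //.
by rewrite -(projDperiod y k) cell_liftK.
Qed.

Lemma cell_lift_continuous a p : (@proj R n @` cell a) p -> {for p, continuous (cell_lift a)}.
Proof.
have [x <-] := proj_surj p => /cell_lift_near[k [_ kx]]; apply: proj_comp_continuous.
have cx := @translate_continuous R n (@period R n k) x.
move=> A /=; have [_ ->] := nbhs_singleton kx => /cx.
by apply: filterS2 kx => y [_ /= ->].
Qed.

Definition torus_chart a : chart R n (@torus_space R n) :=
  @Chart R n _ (@proj R n @` cell a) (cell a) (cell_lift a) (@proj R n)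
    (proj_open (@open_box R n _ _)) (@open_box R n _ _)
    (fun p ap => (cell_liftP ap).1) (fun x ax => ex_intro2 _ _ x ax erefl)
    (fun p ap => (cell_liftP ap).2) (fun x ax => cell_liftK ax)
    (fun p ap => cell_lift_continuous ap) (fun x _ => @proj_continuous R n x).

Lemma near_transition a b x : overlap (torus_chart a) (torus_chart b) x ->
  exists k, \forall y \near x,
    transition (torus_chart a) (torus_chart b) y = y + period k.
Proof. by move=> [ax /cell_lift_near[k [_ kx]]]; exists k; apply: filterS kx => y []. Qed.

Lemma torus_compatible a b : compatible (torus_chart a) (torus_chart b).
Proof.
have smooth_ab c d : smooth_vec_on (overlap (torus_chart c) (torus_chart d))
    (transition (torus_chart c) (torus_chart d)).
  move=> j; apply: near_elementary_smooth => x /near_transition[k kx].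
  exists (fun y => (y + period k) 0 j); first exact: elementary_translate.
  by apply: filterS kx => y ->.
by split.
Qed.

Lemma transition_jacobian a b x : overlap (torus_chart a) (torus_chart b) x ->
  jacobian (transition (torus_chart a) (torus_chart b)) x = 1%:M.
Proof. by move=> /near_transition[k]; exact: jacobian_near_translate. Qed.

Definition torus : smooth_manifold R n.
refine (@SmoothManifold R n (@torus_space R n) (range torus_chart)
  (@torus_hausdorff R n) (@torus_second_countable R n) _ _).
- move=> p; have [x <-] := proj_surj p; exists (torus_chart x); first by exists x.
  by exists x => //; exact: cell_center.
- by move=> _ _ [a _ <-] [b _ <-]; exact: torus_compatible.
Defined.

(** One periodic matrix field can be used in all charts at once, because the transitions are local
    translations by periods. *)
Definition torus_metric (G : 'rV[R]_n -> 'M[R]_n)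
  (eG : forall i j, elementary (fun x => G x i j))
  (symG : forall x, (G x)^T = G x)
  (posG : forall x v, v != 0 -> 0 < inner G x v v)
  (perG : forall x k, G (x + period k) = G x) : riemannian_metric torus.
refine (@RiemannianMetric R n torus (fun=> G) _ _ _ _).
- by move=> c _ i j; apply: elementary_smooth.
- by move=> c _ x _; exact: symG.
- by move=> c _ x _; exact: posG.
- move=> _ _ [a _ <-] [b _ <-] x abx; rewrite transition_jacobian //.
  have [k /nbhs_singleton ->] := near_transition abx.
  by rewrite trmx1 mulmx1 mul1mx perG.
Defined.

Definition torus_foliation (p : nat) : foliation torus p.
refine (@Foliation R n torus p (range torus_chart) _ _ _ _).
- by move=> _ _ [a _ <-] [b _ <-]; exact: torus_compatible.
- move=> q; have [x <-] := proj_surj q; exists (torus_chart x); first by exists x.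
  by exists x => //; exact: cell_center.
- by move=> _ [a _ <-]; exists (a - const_mx 1), (a + const_mx 1).
- move=> _ _ [a _ <-] [b _ <-] x abx i j /andP[ip pj].
  by rewrite transition_jacobian // mxE; case: eqP => // ij; move: pj; rewrite -ij leqNgt ip.
Defined.

Lemma torus_tangentP p (c : chart R n torus) x v : atlas c -> ccod c x ->
  tangent (torus_foliation p) c x v <-> forall j : 'I_n, (p <= j)%N -> v 0 j = 0.
Proof.
move=> [a _ <-] ax; split=> [[_ [b _ <-] [bx vb]] j pj|v0].
  by have := vb j pj; rewrite transition_jacobian ?mulmx1.
exists (torus_chart a); first by exists a.
have aax : overlap (torus_chart a) (torus_chart a) x by split=> //; exists x.
split; first by exists x.
by move=> j pj; rewrite transition_jacobian // mulmx1 v0.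
Qed.

End TorusCharts.

(** * The circle foliation *)

Section TorusLeaves.
Context {R : realType} (n : nat).
Implicit Types (x y a b : 'rV[R]_n.+1) (t s : R).

Definition line x t : 'rV[R]_n.+1 := x + t *: 'e_ord0.

Lemma lineE x t j : line x t 0 j = x 0 j + t * (j == ord0)%:R.
Proof. by rewrite !mxE eqxx. Qed.

Lemma line0 x : line x 0 = x.
Proof. by rewrite /line scale0r addr0. Qed.

Lemma lineD x s t : line (line x s) t = line x (s + t).
Proof. by rewrite /line scalerDl addrA. Qed.

Lemma line_translate x c t : line (x + c) t = line x t + c.
Proof. by rewrite /line addrAC. Qed.

Lemma eq_line x y : (forall j : 'I_n.+1, (1 <= j)%N -> x 0 j = y 0 j) ->
  y = line x (y 0 ord0 - x 0 ord0).
Proof.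
move=> xy; apply/rowP => j; rewrite lineE.
case: (unliftP ord0 j) => [i ->|->]; last by rewrite eqxx mulr1 addrC subrK.
by rewrite -xy // eq_sym (negbTE (neq_lift _ _)) mulr0 addr0.
Qed.

Lemma line_continuous x : continuous (line x).
Proof.
move=> t; apply/continuous_rowP => j.
rewrite (_ : (fun q => _) = fun q => x 0 j + q * (j == ord0)%:R).
  by apply: cvgD; [exact: cvg_cst|apply: cvgMl; exact: cvg_id].
by apply/funext => q; rewrite lineE.
Qed.

Lemma cell_line a t : `|t| < 1 -> cell a (line a t).
Proof.
move=> t1; apply/cellP => i; rewrite lineE addrC addKr normrM.
by case: eqP => _; rewrite ?normr1 ?mulr1 // normr0 mulr0.
Qed.

(** A plaque lies on a line, and lying on a common projected line is itself an equivalence relation.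
    Conversely a displacement [t] is cut into [m > |t|] equal steps, each short enough to stay
    within a single chart. *)
Lemma torus_leaf x :
  leaf (@torus_foliation R n.+1 1) (proj x) = range (fun t => proj (line x t)).
Proof.
apply/seteqP; split=> [z|_ [t _ <-]].
  suff H p q : clos_refl_sym_trans (@torus R n.+1)
      (same_plaque (@torus_foliation R n.+1 1)) p q ->
      exists y t, p = proj y /\ q = proj (line y t).
    move=> /H[y [t [xy ->]]]; move/proj_eqP: xy => [k ->].
    by exists t => //; rewrite line_translate projDperiod.
  elim=> {p q z} [p q [_ [a _ <-] [pa qa pq]]|p|p q _ [y [t [-> ->]]]|
      p q r _ [y [t [-> ->]]] _ [z [s [yz ->]]]].
  - have [_ <-] := cell_liftP pa; have [_ <-] := cell_liftP qa.
    exists (cell_lift a p), (cell_lift a q 0 ord0 - cell_lift a p 0 ord0); split=> //.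
    by rewrite -(eq_line pq).
  - by have [y <-] := proj_surj p; exists y, 0; rewrite line0.
  - by exists (line y t), (- t); rewrite lineD subrr line0.
  - exists y, (t + s); split=> //; move/proj_eqP: yz => [k ->].
    by rewrite line_translate projDperiod lineD.
have small y s : `|s| < 1 ->
    leaf (@torus_foliation R n.+1 1) (proj y) (proj (line y s)).
  move=> s1; apply: rst_step; exists (torus_chart y); first by exists y.
  split; [by exists y => //; exact: cell_center|
          by exists (line y s) => //; exact: cell_line|].
  move=> j j1; rewrite /= !cell_liftK; [|exact: cell_line|exact: cell_center].
  by rewrite lineE; case: eqP j1 => [->//|_ _]; rewrite mulr0 addr0.
have many s m : `|s| < 1 ->
    leaf (@torus_foliation R n.+1 1) (proj x) (proj (line x (s * m%:R))).
  move=> s1; elim: m => [|m IH]; first by rewrite mulr0 line0; exact: rst_refl.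
  apply: rst_trans IH _; rewrite mulrSr mulrDr mulr1 -lineD.
  exact: small.
have [m tm] : exists m : nat, `|t| < m%:R.
  by exists (Num.bound `|t|); apply: archi_boundP.
have m0 : 0 < m%:R :> R by apply: le_lt_trans tm.
rewrite (_ : t = t / m%:R * m%:R); last by rewrite divfK // gt_eqF.
by apply: many; rewrite normrM normfV (gtr0_norm m0) ltr_pdivrMr // mul1r.
Qed.

End TorusLeaves.

(** * Projected coordinate lines as closed geodesics *)

Section DeriveOneVariable.
Context {R : realType}.
Implicit Types (f g : R -> R) (t : R).

Lemma near_eq_derive1n f g t r : (\near t, f t = g t) ->
  \near t, derive1n r f t = derive1n r g t.
Proof.
move=> fg; elim: r => [//|r IH]; apply: filterS (near_near IH) => s fgs.
by rewrite !derive1nS !derive1E; exact: near_eq_derive.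
Qed.

Lemma derive1_affine (a b : R) : derive1 (fun s : R => a + s * b) = fun=> b.
Proof.
apply/funext => s; rewrite derive1E.
rewrite -[fun _ => _]/(cst a + id * cst b) deriveD; first last.
- by apply: derivableM; [exact: derivable_id|exact: derivable_cst].
- exact: derivable_cst.
rewrite deriveM ?derive_cst ?derive_id; first last.
- exact: derivable_cst.
- exact: derivable_id.
by rewrite scaler0 !add0r [_ *: _]mulr1.
Qed.

Lemma derive1n_affine (a b : R) r :
  exists a' b', derive1n r (fun s : R => a + s * b) = fun s => a' + s * b'.
Proof.
elim: r => [|r [a' [b' E]]]; first by exists a, b.
exists b', 0; rewrite derive1nS E derive1_affine.
by apply/funext => s; rewrite mulr0 addr0.
Qed.

Lemma derivable_affine (a b : R) t : derivable (fun s : R => a + s * b) t 1.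
Proof.
by apply: derivableD; [exact: derivable_cst|
  apply: derivableM; [exact: derivable_id|exact: derivable_cst]].
Qed.

End DeriveOneVariable.

Section TorusGeodesics.
Context {R : realType} (n : nat) (G : 'rV[R]_n.+1 -> 'M[R]_n.+1).
Hypotheses (eG : forall i j, elementary (fun x => G x i j))
  (symG : forall x, (G x)^T = G x)
  (posG : forall x v, v != 0 -> 0 < inner G x v v)
  (perG : forall x k, G (x + period k) = G x).

Let g := torus_metric eG symG posG perG.

Lemma torus_curve_coord x (c : chart R n.+1 (@torus R n.+1)) t :
  atlas c -> cdom c (proj (line x t)) ->
  exists a : 'rV[R]_n.+1, forall k, \near t,
    curve_coord c (fun s => proj (line x s)) k t = a 0 k + t * (k == ord0)%:R.
Proof.
move=> [a _ <-] /cell_lift_near[l [_ ll]]; exists (x + period l) => k.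
have H : \forall s \near t, cell_lift a (proj (line x s)) = line x s + period l.
  have ll2 : \forall y \near line x t, cell_lift a (proj y) = y + period l by apply: filterS ll => y [].
  exact: (@line_continuous R n x t _ ll2).
apply: filterS H => s sl.
rewrite /curve_coord /= sl [LHS]mxE lineE [in RHS]mxE.
by rewrite addrAC.
Qed.

(** In every chart the curve is locally affine with velocity ['e_ord0], so only the symbols with
    both lower indices 0 enter the geodesic equation. *)
Lemma torus_geodesic x : (forall k y, christoffel G k ord0 ord0 y = 0) ->
  geodesic g (fun t => proj (line x t)).
Proof.
move=> G00; split.
  split=> [t|c t ac ct k r].
    by apply: continuous_comp; [exact: line_continuous|exact: proj_continuous].
  have [a /(_ k)/(near_eq_derive1n r) ak] := torus_curve_coord ac ct.
  apply/derivable1_diffP; apply: near_eq_differentiable ak _.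
  have [a' [b' ->]] := derive1n_affine (a 0 k) (k == ord0)%:R r.
  by apply/derivable1_diffP; exact: derivable_affine.
move=> c t ac ct k; have [a aP] := torus_curve_coord ac ct.
have d1 i : derive1 (curve_coord c (fun s => proj (line x s)) i) t = (i == ord0)%:R.
  by have /nbhs_singleton := near_eq_derive1n 1 (aP i); rewrite /= derive1_affine.
have /nbhs_singleton -> := near_eq_derive1n 2 (aP k).
rewrite /= derive1_affine derive1E derive_cst add0r.
rewrite big1 // => i _; rewrite big1 // => j _; rewrite !d1.
case: eqP => [->|_]; last by rewrite mulr0 mul0r.
by case: eqP => [->|_]; rewrite ?mulr0 // G00 !mul0r.
Qed.

Lemma torus_closed_geodesic (p : @torus R n.+1) :
  (forall k y, christoffel G k ord0 ord0 y = 0) ->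
  closed_geodesic g (leaf (@torus_foliation R n.+1 1) p).
Proof.
move=> G00; have [x <-] := proj_surj p.
exists (fun t => proj (line x t)), (pi *+ 2); split.
- exact: torus_geodesic.
- by rewrite pmulrn_lgt0 ?pi_gt0.
- move=> t; apply/esym/proj_eqP; exists (fun i => (i == ord0)%:Z).
  apply/rowP => i; rewrite [RHS]mxE !lineE [period _ 0 i]mxE mulrDl addrA.
  by case: eqP => _; rewrite ?mulr1 ?mul1r ?mulr0 ?mul0r.
(* The curve is not constant: the parameter 1 is no integer multiple of 2 pi, hence
   [proj (line x 1)] differs from [proj (line x 0)]. *)
- exists 1 => /proj_eqP[k /rowP/(_ ord0)]; rewrite [RHS]mxE !lineE [period _ 0 _]mxE eqxx !mulr1 addr0 -addrA.
  rewrite -[LHS]addr0 => /addrI /esym E.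
  have pi2 := @pi_ge2 R.
  have : `|(k ord0)%:~R : R| < 1 by rewrite ltr_norml; apply/andP; split; nra.
  rewrite -intr_norm -[1]/(1%:~R) ltr_int => k1.
  have k0 : k ord0 = 0 by lia.
  by move: E; rewrite k0 mul0r addr0 => /eqP; rewrite oner_eq0.
- exact: torus_leaf.
Qed.

End TorusGeodesics.

(** * Forgetting the leaf coordinate: the circle fibration *)

Section TorusFibration.
Context {R : realType} (n : nat).
Implicit Types (x : 'rV[R]_n) (z : 'rV[R]_n.+1) (t : R).

Definition row_cons t x : 'rV[R]_n.+1 :=
  \row_i (if unlift ord0 i is Some j then x 0 j else t).

Definition row_behead z : 'rV[R]_n := \row_j z 0 (lift ord0 j).

Lemma row_cons0 t x : row_cons t x 0 ord0 = t.
Proof. by rewrite mxE unlift_none. Qed.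

Lemma row_consS t x j : row_cons t x 0 (lift ord0 j) = x 0 j.
Proof. by rewrite mxE liftK. Qed.

Lemma row_consK t : cancel (row_cons t) row_behead.
Proof. by move=> x; apply/rowP => j; rewrite mxE row_consS. Qed.

Lemma row_beheadK z : row_cons (z 0 ord0) (row_behead z) = z.
Proof.
apply/rowP => i; case: (unliftP ord0 i) => [j ->|->]; last by rewrite row_cons0.
by rewrite row_consS mxE.
Qed.

Lemma row_behead_period k :
  row_behead (period k) = period (fun j => k (lift ord0 j)).
Proof. by apply/rowP => j; rewrite !mxE. Qed.

Lemma row_beheadD z c : row_behead (z + c) = row_behead z + row_behead c.
Proof. by apply/rowP => j; rewrite !mxE. Qed.

Lemma row_cons_period t x k :
  row_cons t (x + period k) =
  row_cons t x + period (fun i => if unlift ord0 i is Some j then k j else 0).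
Proof.
apply/rowP => i; rewrite [RHS]mxE [period _ 0 i]mxE.
case: (unliftP ord0 i) => [j ->|->].
  by rewrite !row_consS mxE [period _ 0 j]mxE.
by rewrite !row_cons0 mul0r addr0.
Qed.

Lemma row_behead_continuous : continuous row_behead.
Proof.
apply: elementary_row_continuous => j.
rewrite (_ : (fun z => _) = fun z => z 0 (lift ord0 j)).
  exact: elementary_coord.
by apply/funext => z; rewrite mxE.
Qed.

Definition torus_fibration (p : @torus R n.+1) : @torus R n :=
  proj (row_behead (repr p)).

Lemma torus_fibrationE z : torus_fibration (proj z) = proj (row_behead z).
Proof.
rewrite /torus_fibration; have : proj (repr (proj z)) = proj z by rewrite /proj reprK.
move=> /proj_eqP[k zE]; rewrite [in RHS]zE row_beheadD row_behead_period.
by rewrite projDperiod.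
Qed.

Definition fiber_param (b : @torus R n) t : @torus R n.+1 :=
  proj (row_cons t (repr b)).

Lemma fiber_paramE x t : fiber_param (proj x) t = proj (row_cons t x).
Proof.
rewrite /fiber_param; have : proj (repr (proj x)) = proj x by rewrite /proj reprK.
move=> /proj_eqP[k xE]; rewrite [in RHS]xE row_cons_period.
by rewrite projDperiod.
Qed.

Lemma row_cons_continuous :
  continuous (fun q : 'rV[R]_n * R => row_cons q.2 q.1).
Proof.
move=> q; apply/continuous_rowP => i; case: (unliftP ord0 i) => [j ->|->].
  rewrite (_ : (fun _ => _) = (fun y : 'rV[R]_n => y 0 j) \o fst).
    by apply: continuous_comp; [exact: cvg_fst|exact: coord_continuous].
  by apply/funext => r; rewrite row_consS.
rewrite (_ : (fun _ => _) = snd); first exact: cvg_snd.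
by apply/funext => r; rewrite row_cons0.
Qed.

Lemma fiber_param_smooth : smooth_family_on [set: @torus R n] fiber_param.
Proof.
split=> [b t _|_ _ [a _ <-] [d _ <-] Psi j].
  have [x <-] := proj_surj b => A; rewrite /= fiber_paramE => AP.
  have : nbhs (x, t) [set q : 'rV[R]_n * R | A (proj (row_cons q.2 q.1))].
    apply: (@row_cons_continuous (x, t) [set z | A (proj z)]).
    exact: (@proj_continuous R n.+1 (row_cons t x)).
  (* Joint continuity descends to the quotient in the first factor since [proj] maps the
     neighbourhood [P] to a neighbourhood. *)
  move=> [[P Q] [/= xP tQ] PQA]; exists ([set proj y | y in P], Q).
    split=> //=; apply/nbhs_projP; apply: filterS xP => y Py; by exists y.
  move=> [p s] [/= [y Py <-] Qs]; rewrite fiber_paramE; exact: (PQA (y, s)).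
apply: near_elementary_smooth => z [_ _].
have PsiE y : Psi y = proj (row_cons (rsubmx y 0 0) (lsubmx y)).
  by rewrite /Psi /= fiber_paramE.
rewrite PsiE => /cell_lift_near[k [_ kz]].
exists (fun y => (row_cons (rsubmx y 0 0) (lsubmx y) + period k) 0 j).
  rewrite (_ : (fun y => _) = fun y : 'rV[R]_(n + 1) =>
    (if unlift ord0 j is Some i then y 0 (lshift 1 i) else y 0 (rshift n 0))
     + (period k : 'rV[R]_n.+1) 0 j).
    apply: elementaryD; last exact: elementary_cst.
    by case: unlift => [i|]; exact: elementary_coord.
  by apply/funext => y; rewrite [LHS]mxE [row_cons _ _ 0 j]mxE; case: unlift => [i|]; rewrite mxE.
have cz : {for z, continuous (fun y : 'rV[R]_(n + 1) => row_cons (rsubmx y 0 0) (lsubmx y))}.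
  apply: (@elementary_row_continuous R (n + 1) n.+1) => i.
  rewrite (_ : (fun y => _) = fun y : 'rV[R]_(n + 1) =>
    if unlift ord0 i is Some i then y 0 (lshift 1 i) else y 0 (rshift n 0)).
    by case: unlift => [i'|]; exact: elementary_coord.
  by apply/funext => y; rewrite mxE; case: unlift => [i'|]; rewrite mxE.
have H : \forall y \near z,
    cell_lift d (proj (row_cons (rsubmx y 0 0) (lsubmx y))) =
    row_cons (rsubmx y 0 0) (lsubmx y) + period k.
  have kz' : \forall w \near row_cons (rsubmx z 0 0) (lsubmx z),
    cell_lift d (proj w) = w + period k by apply: filterS kz => y [].
  exact: (cz _ kz').
by apply: filterS H => y ky; rewrite /= PsiE ky.
Qed.

Lemma torus_circle_fibration : circle_fibration torus_fibration.
Proof.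
split.
- split=> [p _|_ _ [a _ <-] [d _ <-] j].
    have [z <-] := proj_surj p; apply: proj_comp_continuous.
    rewrite (_ : _ \o _ = @proj R n \o row_behead); last first.
      by apply/funext => y /=; rewrite torus_fibrationE.
    by apply: continuous_comp; [exact: row_behead_continuous|exact: proj_continuous].
  apply: near_elementary_smooth => z [_ [_]]; rewrite /= torus_fibrationE.
  move=> /cell_lift_near[k [_ kz]].
  exists (fun y => y 0 (lift ord0 j) + (period k : 'rV[R]_n) 0 j).
    by apply: elementaryD; [exact: elementary_coord|exact: elementary_cst].
  have H : \forall y \near z,
      cell_lift d (proj (row_behead y)) = row_behead y + period k.
    have kz' : \forall w \near row_behead z,
      cell_lift d (proj w) = w + period k by apply: filterS kz => y [].
    exact: (@row_behead_continuous z _ kz').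
  apply: filterS H => y ky.
  by rewrite /local_expr /= torus_fibrationE ky !mxE.
- move=> b; have [x <-] := proj_surj b; exists (proj (row_cons 0 x)).
  by rewrite torus_fibrationE row_consK.
(* The bundle is trivial, so one trivialization over the whole base serves for every [b]; cosine and
   sine of the leaf coordinate embed the fibre. *)
- move=> b; exists [set: torus n]; split=> //; first exact: openT.
  exists (torus_cos ord0), (torus_sin ord0), fiber_param; split.
  + move=> _ [a _ <-]; apply: elementary_smooth.
    rewrite [X in elementary X](_ : _ = fun y : 'rV[R]_n.+1 => cos (y 0 ord0)).
      exact/elementary_cos/elementary_coord.
    by apply/funext => y; rewrite /= torus_cosE.
  + move=> _ [a _ <-]; apply: elementary_smooth.
    rewrite [X in elementary X](_ : _ = fun y : 'rV[R]_n.+1 => sin (y 0 ord0)).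
      exact/elementary_sin/elementary_coord.
    by apply/funext => y; rewrite /= torus_sinE.
  + exact: fiber_param_smooth.
  + move=> c t _; have [x <-] := proj_surj c; rewrite fiber_paramE.
    by rewrite torus_fibrationE row_consK torus_cosE torus_sinE row_cons0.
  + move=> y _; have [z <-] := proj_surj y.
    rewrite torus_cosE torus_sinE cos2Dsin2; split=> // t ct st.
    rewrite torus_fibrationE fiber_paramE.
    have [k tE] := cos_sin_inj ct st; apply/esym/proj_eqP.
    exists (fun i => if unlift ord0 i is Some _ then 0 else k).
    apply/rowP => i; rewrite [RHS]mxE [period _ 0 i]mxE.
    case: (unliftP ord0 i) => [j ->|->].
      by rewrite row_consS mxE mul0r addr0.
    by rewrite row_cons0.
Qed.

Lemma torus_leaf_fiber (p : @torus R n.+1) :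
  leaf (@torus_foliation R n.+1 1) p = torus_fibration @^-1` [set torus_fibration p].
Proof.
have [z <-] := proj_surj p; rewrite torus_leaf torus_fibrationE.
apply/seteqP; split=> [_ [t _ <-]|q].
  rewrite /= torus_fibrationE; congr proj; apply/rowP => j.
  by rewrite [LHS]mxE [RHS]mxE lineE eq_sym (negbTE (neq_lift _ _)) mulr0 addr0.
have [y <-] := proj_surj q; rewrite /= torus_fibrationE => /proj_eqP[k zy].
(* Another representative of the same point: its tail is exactly that of [z] instead of agreeing up
   to periods, which puts it on the line through [z]. *)
pose y' := row_cons (y 0 ord0) (row_behead z).
exists (y' 0 ord0 - z 0 ord0) => //; rewrite -eq_line.
  by rewrite /y' zy row_cons_period projDperiod row_beheadK.
move=> j; case: (unliftP ord0 j) => [i ->|->] // _.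
by rewrite row_consS mxE.
Qed.

End TorusFibration.

(** * Curvature along a geodesic line field *)

Section LowerChristoffel.
Context {R : realType} {n : nat} (G : 'rV[R]_n -> 'M[R]_n).

Definition metric_partial i j k (x : 'rV[R]_n) : R :=
  partial i (fun y => G y j k) x.

(** Christoffel symbols of the first kind, which involve no inverse matrix. *)
Definition christoffel_lower m i j (x : 'rV[R]_n) : R :=
  2^-1 * (metric_partial i j m x + metric_partial j i m x
          - metric_partial m i j x).

End LowerChristoffel.

Section GeodesicField.
Context {R : realType} (n : nat) (G Ginv : 'rV[R]_n.+1 -> 'M[R]_n.+1).
Implicit Types (x v w : 'rV[R]_n.+1) (i j k l m : 'I_n.+1) (t : R).
Hypotheses (eG : forall i j, elementary (fun x => G x i j))
  (eGinv : forall i j, elementary (fun x => Ginv x i j))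
  (symG : forall x, (G x)^T = G x)
  (invG : forall x, invmx (G x) = Ginv x)
  (mulG : forall x, G x *m Ginv x = 1%:M)
  (G00 : forall x, G x ord0 ord0 = 1)
  (G0_line : forall x t k, G (line x t) ord0 k = G x ord0 k).

Local Notation dG := (metric_partial G).
Local Notation gam := (christoffel_lower G).
Local Notation Gam := (christoffel G).

Lemma partial0_line_invariant (f : 'rV[R]_n.+1 -> R) x :
  (forall y t, f (line y t) = f y) -> partial ord0 f x = 0.
Proof.
move=> fl; rewrite /partial /derive.
rewrite (_ : (fun h => _) = fun=> 0); first by apply: lim_cst; exact: norm_hausdorff.
apply/funext => h /=.
by rewrite [h *: _ + x]addrC -/(line x h) fl subrr scaler0.
Qed.

Lemma partial_line_invariant (f : 'rV[R]_n.+1 -> R) i :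
  (forall y t, f (line y t) = f y) ->
  forall y t, partial i f (line y t) = partial i f y.
Proof.
move=> fl y t; rewrite /partial /derive.
rewrite (_ : (fun h => h^-1 *: (_ - f (line y t))) =
  (fun h => h^-1 *: ((f \o shift y) (h *: 'e_i) - f y))) //; apply/funext => h /=.
by rewrite fl -[f (h *: 'e_i + y)](fl _ t) [_ + y]addrC line_translate
  [_ + line y t]addrC.
Qed.

Let dG_sym i j k x : dG i j k x = dG i k j x.
Proof.
rewrite /metric_partial.
by congr (partial i _ x); apply/funext => y; rewrite -[in LHS]symG mxE.
Qed.

Let dG00 i x : dG i ord0 ord0 x = 0.
Proof.
rewrite /metric_partial -(partial_cst (1 : R) x i).
by congr (partial i _ x); apply/funext => y; rewrite G00.
Qed.

Let d0G0 k x : dG ord0 ord0 k x = 0.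
Proof. by apply: partial0_line_invariant => y t; rewrite G0_line. Qed.

Let d0dG0 i k x : partial ord0 (dG i ord0 k) x = 0.
Proof.
apply: partial0_line_invariant; apply: partial_line_invariant => y t.
exact: G0_line.
Qed.

Let edG i j k : elementary (dG i j k).
Proof. exact: elementary_partial. Qed.

Lemma christoffelE k i j x : Gam k i j x = \sum_l Ginv x k l * gam l i j x.
Proof.
rewrite /christoffel mulr_sumr; apply: eq_bigr => l _.
by rewrite invG mulrCA.
Qed.

Lemma elementary_christoffel_lower m i j : elementary (gam m i j).
Proof.
apply: elementaryM; first exact: elementary_cst.
by apply: elementaryD; [exact: elementaryD|exact: elementaryN].
Qed.

Lemma elementary_christoffel k i j : elementary (Gam k i j).
Proof.
rewrite (_ : Gam k i j = fun x => \sum_l Ginv x k l * gam l i j x).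
  by apply: elementary_sum => l; apply: elementaryM => //;
     exact: elementary_christoffel_lower.
by apply/funext => x; rewrite christoffelE.
Qed.

Lemma christoffel_lowerE m i j x : \sum_k G x m k * Gam k i j x = gam m i j x.
Proof.
under eq_bigr do rewrite christoffelE mulr_sumr.
rewrite exchange_big /= (bigD1 m) //= [X in _ + X]big1 ?addr0.
  under eq_bigr do rewrite mulrA.
  rewrite -mulr_suml; have := congr1 (fun A : 'M[R]_n.+1 => A m m) (mulG x).
  by rewrite /= !mxE eqxx => ->; rewrite mul1r.
move=> l lm; under eq_bigr do rewrite mulrA.
rewrite -mulr_suml; have := congr1 (fun A : 'M[R]_n.+1 => A m l) (mulG x).
by rewrite /= !mxE eq_sym (negbTE lm) => ->; rewrite mul0r.
Qed.

(** With the index lowered, [D_T T] is [T (g(T, .))] minus half of [d (g(T, T))]. The first vanishes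
    by [G0_line], the second by [G00]; the other metric coefficients may vary along the lines. *)
Lemma christoffel00 k x : christoffel G k ord0 ord0 x = 0.
Proof.
rewrite christoffelE big1 // => l _.
by rewrite /christoffel_lower !d0G0 dG00 addr0 subrr !mulr0.
Qed.

Let gam00 k x : gam ord0 ord0 k x = 0.
Proof.
by rewrite /christoffel_lower [dG ord0 k ord0 x]dG_sym dG00 !d0G0 addr0 subrr mulr0.
Qed.

(** Moving the lowering matrix inside the derivative costs one Leibniz term and spares any formula
    for derivatives of the inverse metric. *)
Lemma sum_partial_christoffel i j k x :
  \sum_l G x ord0 l * partial i (Gam l j k) x =
  partial i (gam ord0 j k) x - \sum_l dG i ord0 l x * Gam l j k x.
Proof.
rewrite (_ : gam ord0 j k = fun y => \sum_l G y ord0 l * Gam l j k y); last first.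
  by apply/funext => y; rewrite christoffel_lowerE.
rewrite partial_sum; last first.
  by move=> l; apply: elementaryM => //; exact: elementary_christoffel.
rewrite -sumrB; apply: eq_bigr => l _; rewrite partialM; first by rewrite /metric_partial; ring.
  exact: elementary_differentiable.
exact/elementary_differentiable/elementary_christoffel.
Qed.

Let d0_christoffel_lower j k x :
  partial ord0 (gam ord0 j k) x = - 2^-1 * partial ord0 (dG ord0 j k) x.
Proof.
have d a b c : differentiable (dG a b c) x by exact: elementary_differentiable.
have ds a b : partial ord0 (dG a b ord0) x = 0.
  rewrite -[RHS](d0dG0 a b x); congr (partial ord0 _ x).
  by apply/funext => y; rewrite dG_sym.
rewrite /christoffel_lower partialZ; last first.
  by do 2?[apply: differentiableD => //]; apply: differentiableN.
rewrite partialD; [|exact: differentiableD|exact: differentiableN].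
rewrite partialD; [|exact: d|exact: d].
rewrite partialN; last exact: d.
by rewrite (ds j k) (ds k j) !add0r mulrN mulNr.
Qed.

Let d_christoffel_lower00 j k x : partial j (gam ord0 ord0 k) x = 0.
Proof.
rewrite -(partial_cst (0 : R) x j); congr (partial j _ x).
by apply/funext => y; rewrite gam00.
Qed.

Lemma curvature_coef0 j k x :
  \sum_l G x ord0 l *
    (partial ord0 (Gam l j k) x - partial j (Gam l ord0 k) x
     + \sum_m (Gam m j k x * Gam l ord0 m x - Gam m ord0 k x * Gam l j m x)) =
  - 2^-1 * partial ord0 (dG ord0 j k) x
  + \sum_m Gam m ord0 k x * gam m ord0 j x.
Proof.
have sum_gam a b c : \sum_l G x ord0 l * \sum_m Gam m b c x * Gam l a m x =
    \sum_m Gam m b c x * gam ord0 a m x.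
  under eq_bigr do rewrite mulr_sumr; rewrite exchange_big /=.
  apply: eq_bigr => m _; rewrite -christoffel_lowerE mulr_sumr.
  by apply: eq_bigr => l _; rewrite mulrCA.
have E1 : \sum_l G x ord0 l * partial ord0 (Gam l j k) x =
    - 2^-1 * partial ord0 (dG ord0 j k) x.
  rewrite sum_partial_christoffel d0_christoffel_lower big1 ?subr0 // => l _.
  by rewrite d0G0 mul0r.
have E2 : \sum_l G x ord0 l * partial j (Gam l ord0 k) x =
    - \sum_l dG j ord0 l x * Gam l ord0 k x.
  by rewrite sum_partial_christoffel d_christoffel_lower00 sub0r.
have E3 : \sum_l G x ord0 l * \sum_m Gam m j k x * Gam l ord0 m x = 0.
  by rewrite sum_gam; apply: big1 => m _; rewrite gam00 mulr0.
have E4 := sum_gam j ord0 k.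
have distr (g a b c d : R) :
    g * (a - b + (c - d)) = g * a - g * b + (g * c - g * d) by ring.
have comb (a b c d a' b' c' d' : R) : a = a' -> b = b' -> c = c' -> d = d' ->
    a - b + (c - d) = a' - b' + (c' - d') by move=> -> -> -> ->.
apply: etrans (_ : _ = _) (etrans (comb _ _ _ _ _ _ _ _ E1 E2 E3 E4) _).
  rewrite -!sumrB -big_split /=; apply: eq_bigr => l _.
  by rewrite sumrB; exact: distr.
(* Metric compatibility finishes: the derivative [dG j ord0 m] surviving in [E2], minus the symbol
   [gam ord0 j m] of [E4], is [gam m ord0 j]. *)
rewrite opprK sub0r -addrA; congr (_ + _).
rewrite -sumrB; apply: eq_bigr => m _.
rewrite /christoffel_lower [dG j m ord0 x]dG_sym.
rewrite [dG m j ord0 x]dG_sym.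
move: (Gam _ _ _ _) (dG _ _ _ _) (dG _ _ _ _) (dG _ _ _ _) => a b c d.
by field.
Qed.

Definition line_hessian x : 'M[R]_n.+1 :=
  \matrix_(j, k) partial ord0 (dG ord0 j k) x.

(** The covector [g(D_w T, .)], that is, half of [(T g)(w, .) + d(g(T, .))(w, .)]. Its squared
    length for the inverse metric is the second term of the curvature. *)
Definition line_second_form x w : 'rV[R]_n.+1 :=
  \row_m \sum_j w 0 j * gam m ord0 j x.

Lemma mx_formE (A : 'M[R]_n.+1) v w :
  (v *m A *m w^T) 0 0 = \sum_j \sum_k v 0 j * w 0 k * A j k.
Proof.
rewrite mxE exchange_big /=; apply: eq_bigr => k _.
rewrite !mxE mulr_suml; apply: eq_bigr => j _; ring.
Qed.

Lemma inner_line v x c : inner G x v (c *: 'e_ord0) = c * \sum_l G x ord0 l * v 0 l.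
Proof.
rewrite /inner mx_formE mulr_sumr; apply: eq_bigr => l _.
rewrite (bigD1 ord0) //= big1 ?addr0.
  by rewrite !mxE eqxx mulr1 -[in LHS]symG mxE; ring.
by move=> k k0; rewrite !mxE (negbTE k0) andbF mulr0 mulr0 mul0r.
Qed.

Lemma inner_curvature x c w :
  inner G x (curvature G x (c *: 'e_ord0) w w) (c *: 'e_ord0) =
  c ^+ 2 * (- 2^-1 * (w *m line_hessian x *m w^T) 0 0 +
    (line_second_form x w *m Ginv x *m (line_second_form x w)^T) 0 0).
Proof.
pose K l j k := partial ord0 (Gam l j k) x - partial j (Gam l ord0 k) x
     + \sum_m (Gam m j k x * Gam l ord0 m x - Gam m ord0 k x * Gam l j m x).
have curvE l : curvature G x (c *: 'e_ord0) w w 0 l =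
    c * \sum_j \sum_k w 0 j * w 0 k * K l j k.
  rewrite mxE (bigD1 ord0) //= [X in _ + X]big1 ?addr0.
    rewrite mulr_sumr; apply: eq_bigr => j _; rewrite mulr_sumr.
    by apply: eq_bigr => k _; rewrite !mxE eqxx mulr1 !mulrA.
  move=> i i0; rewrite big1 // => j _; rewrite big1 // => k _.
  by rewrite !mxE (negbTE i0) andbF mulr0 !mul0r.
rewrite inner_line expr2 -mulrA; congr (_ * _).
transitivity (c * \sum_j \sum_k w 0 j * w 0 k * \sum_l G x ord0 l * K l j k).
  rewrite (eq_bigr (fun l => c * \sum_j \sum_k w 0 j * w 0 k * (G x ord0 l * K l j k))).
    rewrite -mulr_sumr exchange_big /=; congr (_ * _); apply: eq_bigr => j _.
    by rewrite exchange_big /=; apply: eq_bigr => k _; rewrite mulr_sumr.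
  move=> l _; rewrite curvE mulrCA mulr_sumr; congr (_ * _); apply: eq_bigr => j _.
  by rewrite mulr_sumr; apply: eq_bigr => k _; rewrite mulrCA.
congr (_ * _); under eq_bigr do under eq_bigr do rewrite curvature_coef0 mulrDr.
under eq_bigr do rewrite big_split /=.
rewrite big_split /=; congr (_ + _).
  rewrite mx_formE mulr_sumr; apply: eq_bigr => j _; rewrite mulr_sumr.
  by apply: eq_bigr => k _; rewrite mxE mulrCA.
rewrite mx_formE.
transitivity (\sum_m \sum_j \sum_k w 0 j * w 0 k * (Gam m ord0 k x * gam m ord0 j x)).
  rewrite [RHS]exchange_big /=; apply: eq_bigr => j _.
  by rewrite [RHS]exchange_big /=; apply: eq_bigr => k _; rewrite mulr_sumr.
apply: eq_bigr => m _; rewrite [line_second_form _ _ 0 m]mxE.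
transitivity ((\sum_j w 0 j * gam m ord0 j x) * \sum_k w 0 k * Gam m ord0 k x).
  rewrite mulr_suml; apply: eq_bigr => j _; rewrite mulr_sumr.
  by apply: eq_bigr => k _; ring.
under [RHS]eq_bigr do rewrite -mulrA; rewrite -mulr_sumr; congr (_ * _).
under eq_bigr do rewrite christoffelE mulr_sumr.
rewrite exchange_big /=; apply: eq_bigr => l _; rewrite [line_second_form _ _ 0 l]mxE.
by rewrite mulr_suml; apply: eq_bigr => k _; rewrite -[RHS]mulrA; congr (_ * _);
  exact: mulrC.
Qed.

End GeodesicField.

(** * The moving frame *)

Section DotProduct.
Context {R : realType} {n : nat}.
Implicit Types (a b c : 'rV[R]_n) (s : R).

Definition dot a b : R := (a *m b^T) 0 0.

Lemma dotE a b : dot a b = \sum_i a 0 i * b 0 i.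
Proof. by rewrite /dot mxE; apply: eq_bigr => i _; rewrite mxE. Qed.

Lemma dotC a b : dot a b = dot b a.
Proof. by rewrite !dotE; apply: eq_bigr => i _; rewrite mulrC. Qed.

Lemma dotDl a b c : dot (a + b) c = dot a c + dot b c.
Proof. by rewrite /dot mulmxDl mxE. Qed.

Lemma dotZl s a b : dot (s *: a) b = s * dot a b.
Proof. by rewrite /dot -scalemxAl mxE. Qed.

Lemma dotNl a b : dot (- a) b = - dot a b.
Proof. by rewrite -scaleN1r dotZl mulN1r. Qed.

Lemma dot0l a : dot 0 a = 0.
Proof. by rewrite /dot mul0mx mxE. Qed.

Lemma dotDr a b c : dot a (b + c) = dot a b + dot a c.
Proof. by rewrite dotC dotDl !(dotC a). Qed.

Lemma dotZr s a b : dot a (s *: b) = s * dot a b.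
Proof. by rewrite dotC dotZl (dotC a). Qed.

Lemma dotNr a b : dot a (- b) = - dot a b.
Proof. by rewrite dotC dotNl (dotC a). Qed.

Lemma dot_suml I (r : seq I) (P : pred I) (F : I -> 'rV[R]_n) b :
  dot (\sum_(i <- r | P i) F i) b = \sum_(i <- r | P i) dot (F i) b.
Proof.
by apply: (big_morph (fun a => dot a b)) => [x y|]; rewrite ?dotDl ?dot0l.
Qed.

Lemma dot_el i a : dot 'e_i a = a 0 i.
Proof. by rewrite /dot -rowE !mxE. Qed.

Lemma dot_er i a : dot a 'e_i = a 0 i.
Proof. by rewrite dotC dot_el. Qed.

Lemma dot_ge0 a : 0 <= dot a a.
Proof. by rewrite dotE; apply: sumr_ge0 => i _; rewrite -expr2 sqr_ge0. Qed.

Lemma dot_eq0 a : (dot a a == 0) = (a == 0).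
Proof.
apply/eqP/eqP => [|->]; last exact: dot0l.
rewrite dotE => /eqP; rewrite psumr_eq0; last by move=> i _; rewrite -expr2 sqr_ge0.
move=> /allP a0; apply/rowP => i; rewrite mxE; apply/eqP.
by have := a0 i (mem_index_enum i); rewrite /= mulf_eq0 orbb.
Qed.

Lemma dot_gt0 a : (0 < dot a a) = (a != 0).
Proof. by rewrite lt_neqAle dot_ge0 andbT eq_sym dot_eq0. Qed.

Lemma mx11_dot a b : a *m b^T = (dot a b)%:M.
Proof. by rewrite [LHS]mx11_scalar. Qed.

Lemma mulmx_outer a b c : a *m (b^T *m c) = dot a b *: c.
Proof. by rewrite mulmxA mx11_dot mul_scalar_mx. Qed.

End DotProduct.

Section MovingFrame.
Context {R : realType} (p : nat).
Local Notation N := (p.+1.*2.+2).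
Implicit Types (v w : 'rV[R]_N) (i j : nat) (k l : 'I_N).

(* Coordinate 0 is the leaf coordinate [t]; the angles [u_0, ..., u_p] and the
   space coordinates [x_0, ..., x_(p+1)] follow. *)
Definition angle_index i : 'I_N := inord i.+1.
Definition space_index i : 'I_N := inord (p.+2 + i).
Local Notation iu := angle_index.
Local Notation ix := space_index.
Local Notation u v i := (v 0 (angle_index i)).

(* The point of the unit sphere of R^(i+1) with spherical coordinates
   u_0, ..., u_(i-1). *)
Fixpoint sphere_pt i v : 'rV[R]_N :=
  if i is j.+1 then cos (u v j) *: sphere_pt j v + sin (u v j) *: 'e_(ix j.+1)
  else 'e_(ix 0).

(** The partial derivative of [sphere_pt i.+1] along angle [i]. The vectors with [i <= p], together
    with [sphere_pt p.+1], form an orthonormal frame of the [p + 2] space coordinates. *)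
Definition sphere_tangent i v : 'rV[R]_N :=
  - sin (u v i) *: sphere_pt i v + cos (u v i) *: 'e_(ix i.+1).

(* The factor 3 makes this an immersion: the partial derivatives of each new
   [sphere_pt] have length at most 1, so those of [immersion] stay of length at
   least 2. *)
Fixpoint immersion i v : 'rV[R]_N :=
  if i is j.+1 then 3 *: immersion j v + 2 *: sphere_pt j.+1 v else 0.

Local Notation D := sphere_pt.
Local Notation tau := sphere_tangent.
Local Notation F := immersion.

Lemma val_angle_index i : (i <= p)%N -> iu i = i.+1 :> nat.
Proof. by move=> ip; rewrite inordK //; lia. Qed.

Lemma val_space_index i : (i <= p.+1)%N -> ix i = (p.+2 + i)%N :> nat.
Proof. by move=> ip; rewrite inordK //; lia. Qed.

Lemma index_cases k : [\/ k = ord0, exists2 i, (i <= p)%N & k = iu i |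
  exists2 i, (i <= p.+1)%N & k = ix i].
Proof.
have [k0|k0] := eqVneq k ord0; first by constructor 1.
have kpos : (0 < k)%N by rewrite lt0n.
have [kp|pk] := leqP k p.+1.
  constructor 2; exists k.-1; first by lia.
  by apply/val_inj; rewrite /= val_angle_index; lia.
have kN := ltn_ord k.
constructor 3; exists (k - p.+2)%N; first by lia.
by apply/val_inj; rewrite /= val_space_index; lia.
Qed.

Lemma angle_index_eq i j : (i <= p)%N -> (j <= p)%N -> (iu i == iu j) = (i == j).
Proof. by move=> ip jp; rewrite -val_eqE /= !val_angle_index. Qed.

Lemma angle_index_neq0 i : (i <= p)%N -> (iu i == ord0) = false.
Proof. by move=> ip; rewrite -val_eqE /= val_angle_index. Qed.

Lemma sphere_pt_space i v k : (i <= p.+1)%N ->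
  (k <= p.+1)%N || (p.+2 + i < k)%N -> D i v 0 k = 0.
Proof.
elim: i => [|i IH] ip kP /=.
  rewrite mxE /= (_ : (k == _) = false) //.
  by apply/negbTE; rewrite -val_eqE /= val_space_index //; lia.
rewrite 4!mxE IH ?mulr0 ?add0r; [|lia|lia].
rewrite /= (_ : (k == _) = false) ?andbF ?mulr0 //.
by apply/negbTE; rewrite -val_eqE /= val_space_index //; lia.
Qed.

Lemma sphere_tangent_space i v k : (i <= p)%N ->
  (k <= p.+1)%N || (p.+3 + i < k)%N -> tau i v 0 k = 0.
Proof.
move=> ip kP; rewrite 4!mxE sphere_pt_space ?mulr0 ?add0r; [|lia|lia].
rewrite /= (_ : (k == _) = false) ?andbF ?mulr0 //.
by apply/negbTE; rewrite -val_eqE /= val_space_index //; lia.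
Qed.

Lemma immersion_space i v k : (i <= p.+1)%N -> (k <= p.+1)%N -> F i v 0 k = 0.
Proof.
elim: i => [|i IH] ip kP; first by rewrite /= mxE.
rewrite [F _ _]/= 3!mxE IH ?(ltnW ip) // mulr0 add0r -/(D i.+1 v).
by rewrite sphere_pt_space ?kP ?mulr0.
Qed.

Lemma sphere_pt_unit i v : (i <= p.+1)%N -> dot (D i v) (D i v) = 1.
Proof.
elim: i => [|i IH] ip /=; first by rewrite dot_el mxE !eqxx.
rewrite !(dotDl, dotDr, dotZl, dotZr) IH; last by lia.
rewrite dot_el !dot_er sphere_pt_space; [|lia|].
  rewrite mxE !eqxx /=; transitivity (cos (u v i) ^+ 2 + sin (u v i) ^+ 2).
    by ring.
  exact: cos2Dsin2.
by rewrite val_space_index //; lia.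
Qed.

Lemma sphere_pt_step i v : (i <= p)%N -> D i v 0 (ix i.+1) = 0.
Proof. by move=> ip; rewrite sphere_pt_space // ?val_space_index //; lia. Qed.

Lemma sphere_tangent_unit i v : (i <= p)%N -> dot (tau i v) (tau i v) = 1.
Proof.
move=> ip; rewrite /sphere_tangent !(dotDl, dotDr, dotZl, dotZr) sphere_pt_unit ?leqW //.
rewrite dot_el !dot_er sphere_pt_step // mxE !eqxx /=.
transitivity (cos (u v i) ^+ 2 + sin (u v i) ^+ 2); last exact: cos2Dsin2.
by ring.
Qed.

Lemma sphere_tangent_step i v : (i <= p)%N -> tau i v 0 (ix i.+1) = cos (u v i).
Proof.
move=> ip; rewrite -dot_er /sphere_tangent dotDl !dotZl !dot_er sphere_pt_step //.
by rewrite mxE !eqxx mulr0 add0r mulr1.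
Qed.

(** Orthogonality at [j = i.+1] is that of a rotated pair. Afterwards each sphere point combines the
    previous one with a new axis, orthogonal to [tau i] because of the supports. *)
Lemma sphere_tangent_pt i j v : (i < j)%N -> (j <= p.+1)%N ->
  dot (tau i v) (D j v) = 0.
Proof.
elim: j => [//|j IH] ij jp.
rewrite [D _ _]/= dotDr !dotZr dot_er.
have [<-|ijne] := eqVneq i j.
  have -> : dot (tau i v) (D i v) = - sin (u v i).
    rewrite /sphere_tangent dotDl !dotZl sphere_pt_unit; last by lia.
    by rewrite dot_el sphere_pt_step; [ring|lia].
  by rewrite sphere_tangent_step; [ring|lia].
rewrite IH ?sphere_tangent_space; [by ring|lia| |lia|lia].
by rewrite val_space_index //; lia.
Qed.

Lemma sphere_tangent_orth i j v : (i < j)%N -> (j <= p)%N ->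
  dot (tau i v) (tau j v) = 0.
Proof.
move=> ij jp; rewrite {2}/sphere_tangent dotDr !dotZr dot_er.
rewrite sphere_tangent_pt ?sphere_tangent_space; [by ring|lia| |lia|lia].
by rewrite val_space_index //; lia.
Qed.

(** The pair [D i.+1], [tau i] is a rotation of [D i] and the axis [i.+1]. Undoing the rotation
    frees one coordinate and lowers [i] by one. *)
Lemma sphere_frame_complete i v w : (i <= p.+1)%N -> dot (D i v) w = 0 ->
  (forall j, (j < i)%N -> dot (tau j v) w = 0) ->
  forall j, (j <= i)%N -> w 0 (ix j) = 0.
Proof.
elim: i => [|i IH] ip Dw tw j ji.
  by move: Dw; rewrite /= dot_el; case: j ji.
have ti := tw i (ltnSn i); move: Dw ti.
rewrite /sphere_tangent /= !(dotDl, dotZl) dot_el.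
set c := cos _; set s := sin _; set d := dot _ _; set e := w 0 _ => h1 h2.
have cs : c ^+ 2 + s ^+ 2 = 1 by exact: cos2Dsin2.
have d0 : d = 0.
  by rewrite -[d]mul1r -cs (_ : _ * d = c * (c * d + s * e) - s * (- s * d + c * e));
    [rewrite h1 h2 !mulr0 subr0|ring].
have e0 : e = 0.
  by rewrite -[e]mul1r -cs (_ : _ * e = s * (c * d + s * e) + c * (- s * d + c * e));
    [rewrite h1 h2 !mulr0 addr0|ring].
move: ji; rewrite leq_eqVlt => /orP[/eqP->//|ji].
by apply: IH; [lia|exact: d0| |lia] => j' j'i; apply: tw; lia.
Qed.

End MovingFrame.

(** * Smoothness, periodicity and derivatives of the frame and of the immersion *)

Section ElementaryMatrices.
Context {R : realType} {n : nat}.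

Definition elementary_mx m1 m2 (A : 'rV[R]_n -> 'M[R]_(m1, m2)) : Prop :=
  forall i j, elementary (fun x => A x i j).

Lemma elementary_mx_cst m1 m2 (A : 'M[R]_(m1, m2)) : elementary_mx (fun=> A).
Proof. by move=> i j; exact: elementary_cst. Qed.

Lemma elementary_mxD m1 m2 (A B : 'rV[R]_n -> 'M[R]_(m1, m2)) :
  elementary_mx A -> elementary_mx B -> elementary_mx (fun x => A x + B x).
Proof.
move=> eA eB i j; rewrite (_ : (fun x => _) = fun x => A x i j + B x i j).
  exact: elementaryD.
by apply/funext => x; rewrite mxE.
Qed.

Lemma elementary_mxZ m1 m2 f (A : 'rV[R]_n -> 'M[R]_(m1, m2)) :
  elementary f -> elementary_mx A -> elementary_mx (fun x => f x *: A x).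
Proof.
move=> ef eA i j; rewrite (_ : (fun x => _) = fun x => f x * A x i j).
  exact: elementaryM.
by apply/funext => x; rewrite mxE.
Qed.

Lemma elementary_mxM m1 m2 m3 (A : 'rV[R]_n -> 'M[R]_(m1, m2))
    (B : 'rV[R]_n -> 'M[R]_(m2, m3)) :
  elementary_mx A -> elementary_mx B -> elementary_mx (fun x => A x *m B x).
Proof.
move=> eA eB i j; rewrite (_ : (fun x => _) = fun x => \sum_k A x i k * B x k j).
  by apply: elementary_sum => k; exact: elementaryM.
by apply/funext => x; rewrite mxE.
Qed.

Lemma elementary_mx_tr m1 m2 (A : 'rV[R]_n -> 'M[R]_(m1, m2)) :
  elementary_mx A -> elementary_mx (fun x => (A x)^T).
Proof.
move=> eA i j; rewrite (_ : (fun x => _) = fun x => A x j i) //.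
by apply/funext => x; rewrite mxE.
Qed.

End ElementaryMatrices.

Section FrameDerivatives.
Context {R : realType} (p : nat).
Local Notation N := (p.+1.*2.+2).
Implicit Types (v w : 'rV[R]_N) (i j : nat) (k l : 'I_N) (t : R).
Local Notation iu := (@angle_index p).
Local Notation u v i := (v 0 (@angle_index p i)).
Local Notation D := (@sphere_pt R p).
Local Notation tau := (@sphere_tangent R p).
Local Notation F := (@immersion R p).

Lemma elementary_sphere_pt i : elementary_mx (D i).
Proof.
elim: i => [|i IH]; first exact: elementary_mx_cst.
by apply: elementary_mxD; apply: elementary_mxZ => //;
  [exact/elementary_cos/elementary_coord|exact/elementary_sin/elementary_coord|
   exact: elementary_mx_cst].
Qed.

Lemma elementary_sphere_tangent i : elementary_mx (tau i).
Proof.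
apply: elementary_mxD; apply: elementary_mxZ.
- exact/elementaryN/elementary_sin/elementary_coord.
- exact: elementary_sphere_pt.
- exact/elementary_cos/elementary_coord.
- exact: elementary_mx_cst.
Qed.

Lemma elementary_immersion i : elementary_mx (F i).
Proof.
elim: i => [|i IH]; first exact: elementary_mx_cst.
apply: elementary_mxD; apply: elementary_mxZ => //; try exact: elementary_cst.
exact: (elementary_sphere_pt i.+1).
Qed.

Lemma sphere_pt_period i v (c : 'I_N -> int) : D i (v + period c) = D i v.
Proof. by elim: i => [//|i IH] /=; rewrite IH !mxE cos_period sin_period. Qed.

Lemma sphere_tangent_period i v (c : 'I_N -> int) : tau i (v + period c) = tau i v.
Proof. by rewrite /sphere_tangent sphere_pt_period !mxE cos_period sin_period. Qed.

Lemma immersion_period i v (c : 'I_N -> int) : F i (v + period c) = F i v.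
Proof.
by elim: i => [//|i IH]; rewrite [LHS]/= [RHS]/= IH -/(D i.+1 _) sphere_pt_period.
Qed.

Lemma angle_line i v t : (i <= p)%N -> u (line v t) i = u v i.
Proof. by move=> ip; rewrite lineE angle_index_neq0 // mulr0 addr0. Qed.

Lemma sphere_pt_line i v t : (i <= p.+1)%N -> D i (line v t) = D i v.
Proof. by elim: i => [//|i IH] ip /=; rewrite angle_line ?IH //; lia. Qed.

Lemma sphere_tangent_line i v t : (i <= p)%N -> tau i (line v t) = tau i v.
Proof. by move=> ip; rewrite /sphere_tangent sphere_pt_line ?angle_line //; lia. Qed.

Lemma immersion_line i v t : (i <= p.+1)%N -> F i (line v t) = F i v.
Proof.
elim: i => [//|i IH] ip; rewrite [LHS]/= [RHS]/= IH; last by lia.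
by rewrite -/(D i.+1 _) sphere_pt_line.
Qed.

Lemma partial_sphere_ptS i v k l : (i <= p)%N ->
  partial k (fun y => D i.+1 y 0 l) v =
  (k == iu i)%:R * tau i v 0 l + cos (u v i) * partial k (fun y => D i y 0 l) v.
Proof.
move=> ip; pose e := ('e_(space_index p i.+1) : 'rV[R]_N) 0 l.
have du : differentiable (fun y : 'rV[R]_N => u y i) v by exact: differentiable_coord.
have dD : differentiable (fun y => D i y 0 l) v.
  by apply: elementary_differentiable; exact: elementary_sphere_pt.
have dc : differentiable (fun y : 'rV[R]_N => cos (u y i)) v.
  exact/elementary_differentiable/elementary_cos/elementary_coord.
have ds : differentiable (fun y : 'rV[R]_N => sin (u y i)) v.
  exact/elementary_differentiable/elementary_sin/elementary_coord.
rewrite (_ : (fun y => _) =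
  fun y : 'rV[R]_N => cos (u y i) * D i y 0 l + sin (u y i) * e); last first.
  by apply/funext => y; rewrite /= [LHS]mxE [X in X + _]mxE [X in _ + X]mxE.
have de : differentiable (fun y : 'rV[R]_N => e) v by exact: differentiable_cst.
rewrite partialD; [|exact: differentiableM|exact: differentiableM].
rewrite partialM // (partialM _ ds de) partial_cst partial_cos // partial_sin //.
rewrite partial_coord (_ : tau i v 0 l = - sin (u v i) * D i v 0 l + cos (u v i) * e).
  ring.
by rewrite [LHS]mxE [X in X + _]mxE [X in _ + X]mxE.
Qed.

(** The factor of [tau i] in the derivative of [sphere_pt j] along angle [i]: the product of the
    cosines of the angles strictly between [i] and [j], or 0 when [j <= i]. *)
Fixpoint sphere_coef i j v : R :=
  if j is j'.+1 then (i == j')%:R + cos (u v j') * sphere_coef i j' v else 0.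

(** At [j = p.+1] these are the lengths [r_i] of the partial derivatives of the immersion, with
    angles counted from 0. *)
Fixpoint immersion_coef i j v : R :=
  if j is j'.+1 then 3 * immersion_coef i j' v + 2 * sphere_coef i j'.+1 v else 0.

Lemma immersion_coefS i j v : immersion_coef i j.+1 v =
  3 * immersion_coef i j v + 2 * sphere_coef i j.+1 v.
Proof. by []. Qed.

Lemma partial_sphere_pt i j v l : (i <= p)%N -> (j <= p.+1)%N ->
  partial (iu i) (fun y => D j y 0 l) v = sphere_coef i j v * tau i v 0 l.
Proof.
move=> ip; elim: j => [|j IH] jp; first by rewrite /= mul0r; exact: partial_cst.
rewrite partial_sphere_ptS // IH ?(ltnW jp) // angle_index_eq //= mulrDl mulrA.
by have [->|] := eqVneq i j; rewrite ?mul0r.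
Qed.

Lemma partial_sphere_pt_other j v k l : (forall i, (i <= p)%N -> k != iu i) ->
  (j <= p.+1)%N -> partial k (fun y => D j y 0 l) v = 0.
Proof.
move=> kP; elim: j => [|j IH] jp; first exact: partial_cst.
by rewrite partial_sphere_ptS // IH ?(ltnW jp) // (negbTE (kP j _)) // mul0r mulr0 addr0.
Qed.

Lemma partial_immersionS i v k l :
  partial k (fun y => F i.+1 y 0 l) v =
  3 * partial k (fun y => F i y 0 l) v + 2 * partial k (fun y => D i.+1 y 0 l) v.
Proof.
have dF : differentiable (fun y => F i y 0 l) v.
  by apply: elementary_differentiable; exact: elementary_immersion.
have dD : differentiable (fun y => D i.+1 y 0 l) v.
  by apply: elementary_differentiable; exact: elementary_sphere_pt.
rewrite (_ : (fun y => _) = fun y => 3 * F i y 0 l + 2 * D i.+1 y 0 l); last first.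
  by apply/funext => y; rewrite [F _ _]/= -/(D i.+1 y) [LHS]mxE [X in X + _]mxE [X in _ + X]mxE.
have d3 : differentiable (fun y : 'rV[R]_N => 3 : R) v by exact: differentiable_cst.
have d2 : differentiable (fun y : 'rV[R]_N => 2 : R) v by exact: differentiable_cst.
rewrite partialD; [|exact: differentiableM|exact: differentiableM].
by rewrite (partialZ _ _ dF) (partialZ _ _ dD).
Qed.

Lemma partial_immersion i j v l : (i <= p)%N -> (j <= p.+1)%N ->
  partial (iu i) (fun y => F j y 0 l) v = immersion_coef i j v * tau i v 0 l.
Proof.
move=> ip; elim: j => [|j IH] jp.
  rewrite /= mul0r -[RHS](partial_cst (0 : R) v (iu i)); congr (partial _ _ _).
  by apply/funext => y; rewrite mxE.
rewrite partial_immersionS IH ?(ltnW jp) // partial_sphere_pt //.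
by rewrite immersion_coefS; ring.
Qed.

Lemma partial_immersion_other j v k l : (forall i, (i <= p)%N -> k != iu i) ->
  (j <= p.+1)%N -> partial k (fun y => F j y 0 l) v = 0.
Proof.
move=> kP; elim: j => [|j IH] jp.
  rewrite -[RHS](partial_cst (0 : R) v k); congr (partial _ _ _).
  by apply/funext => y; rewrite mxE.
by rewrite partial_immersionS IH ?(ltnW jp) // partial_sphere_pt_other // !mulr0 addr0.
Qed.

Lemma sphere_coef_eq0 i j v : (j <= i)%N -> sphere_coef i j v = 0.
Proof.
elim: j => [//|j IH] ji /=; rewrite IH ?(ltnW ji) // mulr0 addr0.
by case: eqP ji => // ->; rewrite ltnn.
Qed.

Lemma sphere_coefSn i v : sphere_coef i i.+1 v = 1.
Proof. by rewrite /= eqxx sphere_coef_eq0 // mulr0 addr0. Qed.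

Lemma sphere_coef_norm i j v : `|sphere_coef i j v| <= 1.
Proof.
elim: j => [|j IH]; first by rewrite /= normr0 ler01.
have [<-|ij] := eqVneq i j; first by rewrite sphere_coefSn normr1.
rewrite /= (negbTE ij) add0r normrM mulr_ile1 // ?normr_ge0 //; exact: cos_max.
Qed.

Lemma immersion_coef_eq0 i j v : (j <= i)%N -> immersion_coef i j v = 0.
Proof.
elim: j => [//|j IH] ji; rewrite immersion_coefS.
by rewrite IH ?sphere_coef_eq0 ?(ltnW ji) // !mulr0 addr0.
Qed.

(** Angle [i] first enters in the summand [2 *: sphere_pt i.+1], with factor 1. For the last angle
    this is the final summand, whence [r_m = 2] exactly, and not merely at least 2. *)
Lemma immersion_coefSn i v : immersion_coef i i.+1 v = 2.
Proof.
rewrite immersion_coefS sphere_coefSn immersion_coef_eq0 //.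
by rewrite mulr0 add0r mulr1.
Qed.

Lemma immersion_coef_ge2 i j v : (i < j)%N -> 2 <= immersion_coef i j v.
Proof.
elim: j => [//|j IH]; rewrite ltnS leq_eqVlt => /orP[/eqP<-|ij].
  by rewrite immersion_coefSn.
rewrite immersion_coefS.
have := sphere_coef_norm i j.+1 v; rewrite ler_norml => /andP[? _].
by have := IH ij; lra.
Qed.

End FrameDerivatives.

Arguments sphere_pt : simpl never.
Arguments immersion : simpl never.
Arguments sphere_coef : simpl never.
Arguments immersion_coef : simpl never.

(** * The twisted metric *)

Lemma outer_mulmx (R : realType) n (a b c d : 'rV[R]_n) :
  (a^T *m b) *m (c^T *m d) = dot b c *: (a^T *m d).
Proof. by rewrite -mulmxA mulmx_outer -scalemxAr. Qed.

(** On the plane of [a] and [b] the first factor has diagonal entries 1 and off-diagonal entries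
    1/2; its inverse has 4/3 and -2/3 there. Both factors are the identity on the orthogonal
    complement. *)
Lemma outer_orthonormal_inverse (R : realType) n (a b : 'rV[R]_n) :
  dot a a = 1 -> dot b b = 1 -> dot a b = 0 ->
  (1%:M + 2^-1 *: (a^T *m b + b^T *m a)) *m
  (1%:M + 3^-1 *: (a^T *m a + b^T *m b) - (2 / 3) *: (a^T *m b + b^T *m a)) = 1%:M.
Proof.
move=> aa bb ab; have ba : dot b a = 0 by rewrite dotC.
rewrite mulmxDl mul1mx -scalemxAl !(mulmxDr, mulmxDl) !mulmxN mulmx1 -!scalemxAr.
rewrite !(mulmxDr, mulmxDl) !outer_mulmx aa bb ab ba !scale1r !scale0r mulmx1.
set X := a^T *m a; set Y := b^T *m b; set Z := a^T *m b; set W := b^T *m a.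
by apply/matrixP => i j; rewrite !mxE; field.
Qed.

Lemma bessel2 (R : realType) n (a b y : 'rV[R]_n) :
  dot a a = 1 -> dot b b = 1 -> dot a b = 0 ->
  dot a y ^+ 2 + dot b y ^+ 2 <= dot y y.
Proof.
move=> aa bb ab; have := dot_ge0 (y - dot a y *: a - dot b y *: b).
rewrite !(dotDl, dotDr, dotNl, dotNr, dotZl, dotZr) aa bb ab (dotC b a) ab.
rewrite (dotC y a) (dotC y b); lra.
Qed.

Section TwistedMetric.
Context {R : realType} {p : nat}.
Local Notation N := (p.+1.*2.+2).
Implicit Types (v w x : 'rV[R]_N) (i j : nat) (k l : 'I_N) (t : R).
Local Notation iu := (@angle_index p).
Local Notation D := (@sphere_pt R p).
Local Notation tau := (@sphere_tangent R p).
Local Notation e0 := ('e_(ord0 : 'I_N) : 'rV[R]_N).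

Definition unit_normal v := sphere_pt p.+1 v.
Definition connection v := immersion p.+1 v.
Definition rotating v : 'rV[R]_N :=
  cos (v 0 ord0) *: 'e_(iu p) - sin (v 0 ord0) *: tau p v.
Definition rotating' v : 'rV[R]_N :=
  - sin (v 0 ord0) *: 'e_(iu p) - cos (v 0 ord0) *: tau p v.

Local Notation nu := unit_normal.
Local Notation beta := connection.
Local Notation q := rotating.
Local Notation q' := rotating'.

Lemma unit_normal_unit v : dot (nu v) (nu v) = 1.
Proof. exact: sphere_pt_unit. Qed.

Lemma unit_normal_small v k : (k <= p.+1)%N -> nu v 0 k = 0.
Proof. by move=> kp; rewrite /nu sphere_pt_space ?kp. Qed.

Lemma connection_small v k : (k <= p.+1)%N -> beta v 0 k = 0.
Proof. by move=> kp; rewrite /beta immersion_space. Qed.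

Lemma tangent_angle v i j : (i <= p)%N -> (j <= p)%N -> tau i v 0 (iu j) = 0.
Proof.
by move=> ip jp; rewrite sphere_tangent_space // val_angle_index // ltnS jp.
Qed.

Lemma dot_angle_normal v j : (j <= p)%N -> dot 'e_(iu j) (nu v) = 0.
Proof.
by move=> jp; rewrite dot_el unit_normal_small // val_angle_index // ltnS.
Qed.

Lemma dot_tangent_normal v i : (i <= p)%N -> dot (tau i v) (nu v) = 0.
Proof. by move=> ip; rewrite /nu sphere_tangent_pt. Qed.

Lemma dot_angle_angle i j : (i <= p)%N -> (j <= p)%N ->
  dot ('e_(iu i) : 'rV[R]_N) 'e_(iu j) = (i == j)%:R.
Proof. by move=> ip jp; rewrite dot_el mxE eqxx angle_index_eq. Qed.

Lemma dot_rotating_l v w :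
  dot (q v) w = cos (v 0 ord0) * w 0 (iu p) - sin (v 0 ord0) * dot (tau p v) w.
Proof. by rewrite /rotating dotDl dotNl !dotZl dot_el. Qed.

Lemma dot_rotating'_l v w :
  dot (q' v) w = - sin (v 0 ord0) * w 0 (iu p) - cos (v 0 ord0) * dot (tau p v) w.
Proof. by rewrite /rotating' dotDl dotNl !dotZl dot_el. Qed.

Lemma rotating_angle v : q v 0 (iu p) = cos (v 0 ord0).
Proof.
by rewrite -dot_el dotC dot_rotating_l dot_er tangent_angle // mxE !eqxx mulr0 subr0 mulr1.
Qed.

Lemma rotating'_angle v : q' v 0 (iu p) = - sin (v 0 ord0).
Proof.
by rewrite -dot_el dotC dot_rotating'_l dot_er tangent_angle // mxE !eqxx mulr0 subr0 mulr1.
Qed.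

Lemma dot_tangent_rotating v : dot (tau p v) (q v) = - sin (v 0 ord0).
Proof.
rewrite dotC dot_rotating_l sphere_tangent_unit // tangent_angle //.
by rewrite mulr0 sub0r mulr1.
Qed.

Lemma dot_tangent_rotating' v : dot (tau p v) (q' v) = - cos (v 0 ord0).
Proof.
rewrite dotC dot_rotating'_l sphere_tangent_unit // tangent_angle //.
by rewrite mulr0 sub0r mulr1.
Qed.

Lemma rotating_unit v : dot (q v) (q v) = 1.
Proof.
rewrite dot_rotating_l rotating_angle dot_tangent_rotating.
by rewrite -(cos2Dsin2 (v 0 ord0)); ring.
Qed.

Lemma rotating'_unit v : dot (q' v) (q' v) = 1.
Proof.
rewrite dot_rotating'_l rotating'_angle dot_tangent_rotating'.
by rewrite -(cos2Dsin2 (v 0 ord0)); ring.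
Qed.

Lemma dot_rotating_rotating' v : dot (q v) (q' v) = 0.
Proof. by rewrite dot_rotating_l rotating'_angle dot_tangent_rotating'; ring. Qed.

Lemma dot_normal_rotating v : dot (nu v) (q v) = 0.
Proof.
rewrite dotC dot_rotating_l unit_normal_small ?val_angle_index // dot_tangent_normal //.
by rewrite !mulr0 subr0.
Qed.

Lemma dot_normal_rotating' v : dot (nu v) (q' v) = 0.
Proof.
rewrite dotC dot_rotating'_l unit_normal_small ?val_angle_index // dot_tangent_normal //.
by rewrite !mulr0 subr0.
Qed.

Lemma rotating0 v : q v 0 ord0 = 0.
Proof.
rewrite -dot_er dot_rotating_l dot_er sphere_tangent_space // mxE
  [ord0 == _]eq_sym.
by rewrite angle_index_neq0 // andbF !mulr0 subr0.
Qed.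

Definition reduced_metric v : 'M[R]_N :=
  1%:M + 2^-1 *: ((nu v)^T *m q v + (q v)^T *m nu v).

Definition reduced_inverse v : 'M[R]_N :=
  1%:M + 3^-1 *: ((nu v)^T *m nu v + (q v)^T *m q v)
  - (2 / 3) *: ((nu v)^T *m q v + (q v)^T *m nu v).

(** The transpose of this unipotent matrix adds [f . dx] to the [dt] component of a row vector. As
    [f] has no leaf component, changing the sign inverts it. *)
Definition shear v : 'M[R]_N := 1%:M + e0^T *m beta v.
Definition unshear v : 'M[R]_N := 1%:M - e0^T *m beta v.

Definition twisted_metric v := (shear v)^T *m reduced_metric v *m shear v.
Definition twisted_inverse v := unshear v *m reduced_inverse v *m (unshear v)^T.

Local Notation G := twisted_metric.
Local Notation Ginv := twisted_inverse.

Lemma dot_connection_e0 v : dot (beta v) e0 = 0.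
Proof. by rewrite dot_er connection_small. Qed.

Lemma shearK v : shear v *m unshear v = 1%:M.
Proof.
rewrite /shear /unshear mulmxDl mul1mx mulmxBr mulmx1 outer_mulmx.
by rewrite dot_connection_e0 scale0r subr0 subrK.
Qed.

Lemma twisted_metricV v : G v *m Ginv v = 1%:M.
Proof.
rewrite /G /Ginv -!mulmxA (mulmxA (shear v)) shearK mul1mx.
rewrite (mulmxA (reduced_metric v)) outer_orthonormal_inverse;
  [|exact: unit_normal_unit|exact: rotating_unit|exact: dot_normal_rotating].
by rewrite mul1mx -trmx_mul -(trmx1 R N); congr trmx; apply/mulmx1C/shearK.
Qed.

Lemma twisted_metric_invmx v : invmx (G v) = Ginv v.
Proof.
have [Gu _] := mulmx1_unit (twisted_metricV v).
by rewrite -[RHS](mulKmx Gu) twisted_metricV mulmx1.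
Qed.

Lemma reduced_metric_sym v : (reduced_metric v)^T = reduced_metric v.
Proof.
by rewrite /reduced_metric linearD /= trmx1 linearZ /= linearD /= !trmx_mul !trmxK addrC addrC [_^T *m nu v + _]addrC.
Qed.

Lemma twisted_metric_sym v : (G v)^T = G v.
Proof. by rewrite /G !trmx_mul trmxK reduced_metric_sym mulmxA. Qed.

Lemma reduced_form v (y : 'rV[R]_N) :
  (y *m reduced_metric v *m y^T) 0 0 = dot y y + dot (nu v) y * dot (q v) y.
Proof.
rewrite /reduced_metric mulmxDr mulmx1 -scalemxAr mulmxDr !mulmx_outer.
rewrite -/(dot _ y) dotDl dotZl dotDl !dotZl (dotC y (nu v)) (dotC y (q v)).
by field.
Qed.

Lemma inner_twisted v w :
  inner G v w w = dot (w + dot (beta v) w *: e0) (w + dot (beta v) w *: e0)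
    + dot (nu v) w * dot (q v) w.
Proof.
have wsh : w *m (shear v)^T = w + dot (beta v) w *: e0.
  rewrite /shear linearD /= trmx1 trmx_mul trmxK mulmxDr mulmx1.
  by rewrite mulmx_outer dotC.
have -> : inner G v w w =
    ((w *m (shear v)^T) *m reduced_metric v *m (w *m (shear v)^T)^T) 0 0.
  by rewrite /inner /G trmx_mul trmxK !mulmxA.
rewrite wsh reduced_form; set y := w + _; congr (_ + _ * _).
  by rewrite /y dotDr dotZr dot_er unit_normal_small // mulr0 addr0.
by rewrite /y dotDr dotZr dot_er rotating0 mulr0 addr0.
Qed.

Lemma twisted_metric_pos v w : w != 0 -> 0 < inner G v w w.
Proof.
move=> w0; rewrite inner_twisted; set y := w + _.
set n := dot (nu v) w; set A := dot (q v) w.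
have yn : dot y (nu v) = n.
  by rewrite /y dotDl dotZl dot_el unit_normal_small // mulr0 addr0 dotC.
have yq : dot y (q v) = A.
  by rewrite /y dotDl dotZl dot_el rotating0 // mulr0 addr0 dotC.
have y0 : y != 0.
  apply/eqP => yE; have wE : w = - (dot (beta v) w *: e0).
    by apply/eqP; rewrite -addr_eq0; apply/eqP; exact: yE.
  have b0 : dot (beta v) w = 0.
    by rewrite {1}wE dotNr dotZr dot_connection_e0 mulr0 oppr0.
  by move: w0; rewrite wE b0 scale0r oppr0 eqxx.
(* By Bessel's inequality [|n A| <= (n^2 + A^2) / 2 <= |y|^2 / 2], so at least half of [|y|^2]
   remains. *)
have := bessel2 y (unit_normal_unit v) (rotating_unit v) (dot_normal_rotating v).
rewrite (dotC _ y) yn (dotC _ y) yq; move: y0; rewrite -dot_gt0; nra.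
Qed.

End TwistedMetric.

(** * Coefficients of the twisted metric and their derivatives *)

Section TwistedMetricCurvature.
Context {R : realType} {p : nat}.
Local Notation N := (p.+1.*2.+2).
Implicit Types (v w x : 'rV[R]_N) (i j : nat) (k l : 'I_N) (t : R).
Local Notation iu := (@angle_index p).
Local Notation tau := (@sphere_tangent R p).
Local Notation e0 := ('e_(ord0 : 'I_N) : 'rV[R]_N).
Local Notation nu := (@unit_normal R p).
Local Notation beta := (@connection R p).
Local Notation q := (@rotating R p).
Local Notation q' := (@rotating' R p).
Local Notation G := (@twisted_metric R p).
Local Notation Ginv := (@twisted_inverse R p).

(** Only the last summand depends on the leaf coordinate, through [q]; this is what makes the
    derivatives along the leaves short. *)
Lemma twisted_metricE v k l : G v k l =
  (k == l)%:R + (k == ord0)%:R * beta v 0 l + beta v 0 k * (l == ord0)%:R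
  + beta v 0 k * beta v 0 l + 2^-1 * (nu v 0 k * q v 0 l + q v 0 k * nu v 0 l).
Proof.
have re : reduced_metric v *m e0^T = e0^T.
  rewrite /reduced_metric mulmxDl mul1mx -scalemxAl mulmxDl -!mulmxA.
  have -> : q v *m e0^T = 0 by rewrite mx11_dot dot_er rotating0 raddf0.
  have -> : nu v *m e0^T = 0 by rewrite mx11_dot dot_er unit_normal_small // raddf0.
  by rewrite !mulmx0 addr0 scaler0 addr0.
have er : e0 *m reduced_metric v = e0.
  by apply: trmx_inj; rewrite trmx_mul reduced_metric_sym re.
have -> : G v = reduced_metric v + e0^T *m beta v + ((beta v)^T *m e0 + (beta v)^T *m beta v).
  have sT : (shear v)^T = 1%:M + (beta v)^T *m e0.
    by rewrite /shear linearD /= trmx1 trmx_mul trmxK.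
  rewrite /twisted_metric sT /shear mulmxDl mul1mx.
  rewrite -mulmxA er mulmxDr mulmx1 mulmxDl outer_mulmx.
  by rewrite (mulmxA (reduced_metric v)) re dot_el mxE !eqxx scale1r addrACA.
have outer (a b : 'rV[R]_N) : (a^T *m b) k l = a 0 k * b 0 l.
  by rewrite mxE big_ord1 mxE.
have addE (A B : 'M[R]_N) : (A + B) k l = A k l + B k l by rewrite mxE.
have scaleE c (A : 'M[R]_N) : (c *: A) k l = c * A k l by rewrite mxE.
have e0E m : e0 0 m = (m == ord0)%:R by rewrite mxE eqxx.
rewrite /reduced_metric !addE scaleE !addE !outer !e0E.
by rewrite [_%:M k l]mxE; ring.
Qed.

Lemma twisted_metric0 v l : G v ord0 l = (l == ord0)%:R + beta v 0 l.
Proof.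
have b0 : beta v 0 ord0 = 0 by exact: connection_small.
have n0 : nu v 0 ord0 = 0 by exact: unit_normal_small.
by rewrite twisted_metricE b0 n0 rotating0 eqxx eq_sym mul1r !mul0r !addr0 mulr0 addr0.
Qed.

Lemma elementary_normal : elementary_mx nu.
Proof. exact: elementary_sphere_pt. Qed.

Lemma elementary_connection : elementary_mx beta.
Proof. exact: elementary_immersion. Qed.

Lemma elementary_rotating : elementary_mx q.
Proof.
rewrite (_ : q = fun x => cos (x 0 ord0) *: 'e_(iu p) + (- sin (x 0 ord0)) *: tau p x).
  apply: elementary_mxD; apply: elementary_mxZ.
  - exact/elementary_cos/elementary_coord.
  - exact: elementary_mx_cst.
  - exact/elementaryN/elementary_sin/elementary_coord.
  - exact: elementary_sphere_tangent.
by apply/funext => x; rewrite scaleNr.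
Qed.

Lemma elementary_rotating' : elementary_mx q'.
Proof.
rewrite (_ : q' = fun x => (- sin (x 0 ord0)) *: 'e_(iu p) + (- cos (x 0 ord0)) *: tau p x).
  apply: elementary_mxD; apply: elementary_mxZ.
  - exact/elementaryN/elementary_sin/elementary_coord.
  - exact: elementary_mx_cst.
  - exact/elementaryN/elementary_cos/elementary_coord.
  - exact: elementary_sphere_tangent.
by apply/funext => x; rewrite [X in _ = _ + X]scaleNr.
Qed.

Lemma elementary_twisted_metric k l : elementary (fun x => G x k l).
Proof.
have en := elementary_normal; have eq := elementary_rotating.
have eb := elementary_connection; move: k l; rewrite -/(elementary_mx G).
have eu : elementary_mx (fun x => shear x).
  apply: elementary_mxD; first exact: elementary_mx_cst.
  by apply: elementary_mxM => //; exact: elementary_mx_cst.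
apply: elementary_mxM => //; apply: elementary_mxM; first exact: elementary_mx_tr.
apply: elementary_mxD; first exact: elementary_mx_cst.
apply: elementary_mxZ; first exact: elementary_cst.
by apply: elementary_mxD; apply: elementary_mxM => //; exact: elementary_mx_tr.
Qed.

Lemma elementary_twisted_inverse k l : elementary (fun x => Ginv x k l).
Proof.
have en := elementary_normal; have eq := elementary_rotating.
have eb := elementary_connection; move: k l; rewrite -/(elementary_mx Ginv).
have eN m1 m2 (A : 'rV[R]_N -> 'M[R]_(m1, m2)) : elementary_mx A ->
    elementary_mx (fun x => - A x).
  move=> eA; rewrite (_ : (fun x => _) = fun x => -1 *: A x).
    by apply: elementary_mxZ => //; exact: elementary_cst.
  by apply/funext => x; rewrite scaleN1r.
have eu : elementary_mx (fun x => unshear x).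
  apply: elementary_mxD; first exact: elementary_mx_cst.
  by apply/eN/elementary_mxM => //; exact: elementary_mx_cst.
apply: elementary_mxM; last exact: elementary_mx_tr.
apply: elementary_mxM => //.
apply: elementary_mxD; last apply: eN; last first.
- apply: elementary_mxZ; first exact: elementary_cst.
  by apply: elementary_mxD; apply: elementary_mxM => //; exact: elementary_mx_tr.
apply: elementary_mxD; first exact: elementary_mx_cst.
apply: elementary_mxZ; first exact: elementary_cst.
by apply: elementary_mxD; apply: elementary_mxM => //; exact: elementary_mx_tr.
Qed.

Lemma twisted_metric_period v (c : 'I_N -> int) : G (v + period c) = G v.
Proof.
have n_ : nu (v + period c) = nu v by exact: sphere_pt_period.
have b_ : beta (v + period c) = beta v by exact: immersion_period.
have q_ : q (v + period c) = q v.
  by rewrite /rotating sphere_tangent_period !mxE cos_period sin_period.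
by rewrite /twisted_metric /reduced_metric /shear n_ b_ q_.
Qed.

Lemma twisted_metric0_line v t k : G (line v t) ord0 k = G v ord0 k.
Proof. by rewrite !twisted_metric0 /connection immersion_line. Qed.

Lemma twisted_metric00 v : G v ord0 ord0 = 1.
Proof. by rewrite twisted_metric0 eqxx connection_small // addr0. Qed.

Lemma partial0_normal v l : partial ord0 (fun y => nu y 0 l) v = 0.
Proof.
by apply: partial0_line_invariant => y t; rewrite /unit_normal sphere_pt_line.
Qed.

Lemma partial0_tangent v l : partial ord0 (fun y => tau p y 0 l) v = 0.
Proof.
by apply: partial0_line_invariant => y t; rewrite sphere_tangent_line.
Qed.

Lemma partial0_rotating v l : partial ord0 (fun y => q y 0 l) v = q' v 0 l.
Proof.
pose e := ('e_(iu p) : 'rV[R]_N) 0 l.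
have dt : differentiable (fun y : 'rV[R]_N => y 0 ord0) v by exact: differentiable_coord.
have dc : differentiable (fun y : 'rV[R]_N => cos (y 0 ord0)) v.
  exact/elementary_differentiable/elementary_cos/elementary_coord.
have ds : differentiable (fun y : 'rV[R]_N => sin (y 0 ord0)) v.
  exact/elementary_differentiable/elementary_sin/elementary_coord.
have dT : differentiable (fun y => tau p y 0 l) v.
  by apply: elementary_differentiable; exact: elementary_sphere_tangent.
have de : differentiable (fun y : 'rV[R]_N => e) v by exact: differentiable_cst.
rewrite (_ : (fun y => _) = fun y : 'rV[R]_N =>
    cos (y 0 ord0) * e + - (sin (y 0 ord0) * tau p y 0 l)); last first.
  by apply/funext => y; rewrite [LHS]mxE [X in X + _]mxE [X in _ + X]mxE [X in _ - X]mxE.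
rewrite partialD; [|exact: differentiableM|exact/differentiableN/differentiableM].
rewrite partialN; last exact: differentiableM.
rewrite (partialM _ dc de) (partialM _ ds dT) partial_cst partial0_tangent.
rewrite partial_cos // partial_sin // partial_coord eqxx !mulr1.
rewrite (_ : q' v 0 l = - sin (v 0 ord0) * e - cos (v 0 ord0) * tau p v 0 l).
  by ring.
by rewrite [LHS]mxE [X in X + _]mxE [X in _ + X]mxE [X in _ - X]mxE.
Qed.

Lemma partial0_rotating' v l : partial ord0 (fun y => q' y 0 l) v = - q v 0 l.
Proof.
pose e := ('e_(iu p) : 'rV[R]_N) 0 l.
have dt : differentiable (fun y : 'rV[R]_N => y 0 ord0) v by exact: differentiable_coord.
have dc : differentiable (fun y : 'rV[R]_N => cos (y 0 ord0)) v.
  exact/elementary_differentiable/elementary_cos/elementary_coord.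
have ds : differentiable (fun y : 'rV[R]_N => sin (y 0 ord0)) v.
  exact/elementary_differentiable/elementary_sin/elementary_coord.
have dT : differentiable (fun y => tau p y 0 l) v.
  by apply: elementary_differentiable; exact: elementary_sphere_tangent.
have de : differentiable (fun y : 'rV[R]_N => e) v by exact: differentiable_cst.
rewrite (_ : (fun y => _) = fun y : 'rV[R]_N =>
    - (sin (y 0 ord0) * e + cos (y 0 ord0) * tau p y 0 l)); last first.
  apply/funext => y; rewrite [LHS]mxE [X in X + _]mxE [X in _ + X]mxE [X in _ - X]mxE.
  by rewrite opprD mulNr.
rewrite partialN; last by apply: differentiableD; exact: differentiableM.
rewrite partialD; [|exact: differentiableM|exact: differentiableM].
rewrite (partialM _ ds de) (partialM _ dc dT) partial_cst partial0_tangent.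
rewrite partial_cos // partial_sin // partial_coord eqxx !mulr1.
rewrite (_ : q v 0 l = cos (v 0 ord0) * e - sin (v 0 ord0) * tau p v 0 l).
  by ring.
by rewrite [LHS]mxE [X in X + _]mxE [X in _ + X]mxE [X in _ - X]mxE.
Qed.

Lemma partial0_sym_outer (r s r' s' : 'rV[R]_N -> 'rV[R]_N) v k l :
  elementary_mx r -> elementary_mx s ->
  (forall m, partial ord0 (fun y => r y 0 m) v = r' v 0 m) ->
  (forall m, partial ord0 (fun y => s y 0 m) v = s' v 0 m) ->
  partial ord0 (fun y => r y 0 k * s y 0 l + s y 0 k * r y 0 l) v =
  r v 0 k * s' v 0 l + r' v 0 k * s v 0 l
  + (s v 0 k * r' v 0 l + s' v 0 k * r v 0 l).
Proof.
move=> er es dr ds; have dm (f g : 'rV[R]_N -> R) : elementary f -> elementary g ->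
    differentiable (fun y => f y * g y) v.
  by move=> ef eg; apply/elementary_differentiable/elementaryM.
rewrite partialD ?partialM; try exact: elementary_differentiable; try exact: dm.
by rewrite !dr !ds [s v 0 l * _]mulrC [r v 0 l * _]mulrC.
Qed.

Lemma partial0_twisted_metric v k l : metric_partial G ord0 k l v =
  2^-1 * (nu v 0 k * q' v 0 l + q' v 0 k * nu v 0 l).
Proof.
have en := elementary_normal; have eq := elementary_rotating.
have eb := elementary_connection.
have dn := partial0_normal v.
have dq := partial0_rotating v.
pose H y := (k == l)%:R + (k == ord0)%:R * beta y 0 l + beta y 0 k * (l == ord0)%:R
  + beta y 0 k * beta y 0 l.
have eH : elementary H.
  by repeat first [exact: elementary_cst | exact: eb | apply: elementaryD |
    apply: elementaryM].
have dH : partial ord0 H v = 0.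
  apply: partial0_line_invariant => y t.
  by rewrite /H /connection !immersion_line.
have eS : elementary (fun y => nu y 0 k * q y 0 l + q y 0 k * nu y 0 l).
  by apply: elementaryD; exact: elementaryM.
rewrite /metric_partial (_ : (fun y => _) =
  fun y => H y + 2^-1 * (nu y 0 k * q y 0 l + q y 0 k * nu y 0 l)); last first.
  by apply/funext => y; rewrite twisted_metricE.
have d1 := elementary_differentiable v eH; have d2 := elementary_differentiable v eS.
have d3 : differentiable (fun y => 2^-1 * (nu y 0 k * q y 0 l + q y 0 k * nu y 0 l)) v.
  by apply: elementary_differentiable; apply: elementaryM => //; exact: elementary_cst.
rewrite (partialD _ d1 d3) dH add0r (partialZ _ _ d2); congr (_ * _).
have dn0 m : partial ord0 (fun y => nu y 0 m) v = (0 : 'rV[R]_N) 0 m.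
  by rewrite dn mxE.
rewrite (@partial0_sym_outer nu q (fun=> 0) q' v k l en eq dn0 dq).
have z m : (0 : 'rV[R]_N) 0 m = 0 by rewrite mxE.
by rewrite !z mul0r addr0 mulr0 add0r.
Qed.

Lemma line_hessian_twisted v k l : line_hessian G v k l =
  - 2^-1 * (nu v 0 k * q v 0 l + q v 0 k * nu v 0 l).
Proof.
have en := elementary_normal; have eq := elementary_rotating'.
have dn := partial0_normal v; have dq := partial0_rotating' v.
have eS : elementary (fun y => nu y 0 k * q' y 0 l + q' y 0 k * nu y 0 l).
  by apply: elementaryD; exact: elementaryM.
rewrite mxE (_ : metric_partial G ord0 k l =
  fun y => 2^-1 * (nu y 0 k * q' y 0 l + q' y 0 k * nu y 0 l)); last first.
  by apply/funext => y; rewrite partial0_twisted_metric.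
have d2 := elementary_differentiable v eS.
rewrite (partialZ _ _ d2).
have dn0 m : partial ord0 (fun y => nu y 0 m) v = (0 : 'rV[R]_N) 0 m.
  by rewrite dn mxE.
have dqN m : partial ord0 (fun y => q' y 0 m) v = (- q v) 0 m.
  by rewrite dq [RHS]mxE.
rewrite (@partial0_sym_outer nu q' (fun=> 0) (fun x => - q x) v k l en eq dn0 dqN).
have z m : (0 : 'rV[R]_N) 0 m = 0 by rewrite mxE.
have NE m : (- q v) 0 m = - q v 0 m by rewrite mxE.
by rewrite !NE !z; ring.
Qed.

Lemma partial_connection v k l : partial k (fun y => beta y 0 l) v =
  \sum_(i < p.+1) (k == iu i)%:R * (immersion_coef i p.+1 v * tau i v 0 l).
Proof.
have other : (forall i, (i <= p)%N -> k != iu i) ->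
    partial k (fun y => beta y 0 l) v =
    \sum_(i < p.+1) (k == iu i)%:R * (immersion_coef i p.+1 v * tau i v 0 l).
  move=> kP; apply: etrans (partial_immersion_other v l kP (leqnn p.+1)) _.
  apply/esym; apply: big1 => i _.
  have ip : (i <= p)%N by rewrite -ltnS.
  by rewrite (negbTE (kP i ip)) mul0r.
have [k0|[i ip kE]|[i ip kE]] := index_cases k.
- by apply: other => i ip; rewrite k0 eq_sym angle_index_neq0.
- have ip' : (i < p.+1)%N by rewrite ltnS.
  rewrite kE; apply: etrans (partial_immersion v l ip (leqnn p.+1)) _.
  rewrite (bigD1 (Ordinal ip')) //= eqxx mul1r big1 ?addr0 // => j ji.
  have jp : (j <= p)%N by rewrite -ltnS.
  rewrite angle_index_eq // (_ : (i == j) = false) ?mul0r //.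
  by apply/negbTE; rewrite eq_sym.
- apply: other => j jp; rewrite kE -val_eqE /= val_space_index // val_angle_index //.
  by apply/eqP; lia.
Qed.

End TwistedMetricCurvature.

(** * The mixed curvature as a sum of squares *)

Lemma outer_inverse_form (R : realType) n (a b y : 'rV[R]_n) :
  (y *m (1%:M + 3^-1 *: (a^T *m a + b^T *m b)
         - (2 / 3) *: (a^T *m b + b^T *m a)) *m y^T) 0 0 =
  dot y y + 3^-1 * (dot y a ^+ 2 + dot y b ^+ 2) - 4 / 3 * (dot y a * dot y b).
Proof.
rewrite mulmxBr mulmxDr mulmx1 -!scalemxAr !mulmxDr !mulmx_outer -/(dot _ y).
by rewrite !(dotDl, dotNl, dotZl) (dotC a) (dotC b); field.
Qed.

(** Only the block of [a] and [b], with entries 4/3 and -2/3, differs from the identity; [c] and [z]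
    contribute their Euclidean squares. *)
Lemma outer_inverse_orthonormal (R : realType) n (a b c z y : 'rV[R]_n) (r s t : R) :
  dot a a = 1 -> dot b b = 1 -> dot c c = 1 ->
  dot a b = 0 -> dot a c = 0 -> dot b c = 0 ->
  dot z a = 0 -> dot z b = 0 -> dot z c = 0 ->
  y = r *: a + s *: b + t *: c + z ->
  dot y y + 3^-1 * (dot y a ^+ 2 + dot y b ^+ 2) - 4 / 3 * (dot y a * dot y b) =
  4 / 3 * (r ^+ 2 + s ^+ 2 - r * s) + t ^+ 2 + dot z z.
Proof.
move=> aa bb cc ab ac bc za zb zc ->.
rewrite !(dotDl, dotDr, dotZl, dotZr) (dotC b a) (dotC c a) (dotC c b).
rewrite (dotC a z) (dotC b z) (dotC c z) aa bb cc ab ac bc za zb zc; by field.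
Qed.

Section TwistedMetricMixedCurvature.
Context {R : realType} {p : nat}.
Local Notation N := (p.+1.*2.+2).
Implicit Types (v w x : 'rV[R]_N) (i j : nat) (k l m : 'I_N) (t : R).
Local Notation iu := (@angle_index p).
Local Notation tau := (@sphere_tangent R p).
Local Notation e0 := ('e_(ord0 : 'I_N) : 'rV[R]_N).
Local Notation nu := (@unit_normal R p).
Local Notation beta := (@connection R p).
Local Notation q := (@rotating R p).
Local Notation q' := (@rotating' R p).
Local Notation G := (@twisted_metric R p).
Local Notation Ginv := (@twisted_inverse R p).
Local Notation coef i v := (immersion_coef i p.+1 v).

Lemma rotating'0 v : q' v 0 ord0 = 0.
Proof.
rewrite -dot_er dot_rotating'_l dot_er sphere_tangent_space // mxE
  [ord0 == _]eq_sym.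
by rewrite angle_index_neq0 // andbF !mulr0 subr0.
Qed.

Lemma partial_twisted_metric0 v k l : metric_partial G k ord0 l v =
  \sum_(i < p.+1) (k == iu i)%:R * (coef i v * tau i v 0 l).
Proof.
rewrite -partial_connection /metric_partial.
rewrite (_ : (fun y => _) = fun y => (l == ord0)%:R + beta y 0 l); last first.
  by apply/funext => y; rewrite twisted_metric0.
have db : differentiable (fun y => beta y 0 l) v.
  by apply: elementary_differentiable; exact: elementary_connection.
have d1 : differentiable (fun y : 'rV[R]_N => (l == ord0)%:R : R) v.
  exact: differentiable_cst.
by rewrite (partialD _ d1 db) partial_cst add0r.
Qed.

(** The covector [d(f . dx)(w, .)]: the 2-form is the sum of the wedge products of [r_i du_i] with
    [tau_i . dx]. *)
Definition curl v w : 'rV[R]_N :=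
  \sum_(i < p.+1) coef i v *:
    (w 0 (iu i) *: tau i v - dot (tau i v) w *: 'e_(iu i)).

Lemma line_second_form_twisted v w : line_second_form G v w =
  2^-1 *: (2^-1 *: (dot (nu v) w *: q' v + dot (q' v) w *: nu v) + curl v w).
Proof.
apply/rowP => m; rewrite [LHS]mxE.
have scE c (a : 'rV[R]_N) : (c *: a) 0 m = c * a 0 m by rewrite mxE.
have adE (a b : 'rV[R]_N) : (a + b) 0 m = a 0 m + b 0 m by rewrite mxE.
rewrite scE adE scE adE !scE.
have -> : curl v w 0 m =
    \sum_k w 0 k * metric_partial G k ord0 m v - \sum_k w 0 k * metric_partial G m ord0 k v.
  under [X in X - _]eq_bigr do rewrite partial_twisted_metric0 mulr_sumr.
  under [X in _ - X]eq_bigr do rewrite partial_twisted_metric0 mulr_sumr.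
  rewrite exchange_big [X in _ - X]exchange_big /= -sumrB /curl summxE.
  apply: eq_bigr => i _; rewrite scE adE scE -scaleNr scE mulrDr; congr (_ + _).
    rewrite (bigD1 (iu i)) //= eqxx big1 ?addr0; first by rewrite mul1r mulrCA.
    by move=> k /negbTE ->; rewrite mul0r mulr0.
  have -> : ('e_(iu i) : 'rV[R]_N) 0 m = (m == iu i)%:R by rewrite mxE eqxx.
  rewrite dotE mulNr mulrN; congr (- _); rewrite mulr_suml mulr_sumr.
  by apply: eq_bigr => k _; ring.
have -> : 2^-1 * (dot (nu v) w * q' v 0 m + dot (q' v) w * nu v 0 m) =
    \sum_k w 0 k * metric_partial G ord0 k m v.
  under eq_bigr do rewrite partial0_twisted_metric.
  rewrite !dotE !mulr_suml -big_split mulr_sumr; apply: eq_bigr => k _ /=.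
  by ring.
rewrite addrA -big_split -sumrB mulr_sumr /=; apply: eq_bigr => k _.
by rewrite /christoffel_lower; ring.
Qed.

(** The angles before the last one. This is the [z(w)] of the squared terms, orthogonal to [nu], [q]
    and [q']. *)
Definition curl_rest v w : 'rV[R]_N :=
  \sum_(i < p) coef i v *:
    (w 0 (iu i) *: tau i v - dot (tau i v) w *: 'e_(iu i)).

(** The summand of the last angle is twice an area form in the plane of ['e_(iu p)] and [tau p]. Its
    expression is the same in every orthonormal frame of that plane up to orientation, in particular
    in the frame of [q] and [q']. *)
Lemma curlE v w : curl v w =
  2 *: (dot (q' v) w *: q v - dot (q v) w *: q' v) + curl_rest v w.
Proof.
rewrite /curl big_ord_recr /= immersion_coefSn addrC; congr (2 *: _ + _).
rewrite dot_rotating_l dot_rotating'_l /rotating /rotating'.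
set a := w 0 _; set b := dot _ w; set c := cos _; set s := sin _.
have cs : c ^+ 2 + s ^+ 2 = 1 by exact: cos2Dsin2.
move: (tau p v) ('e_(iu p)) a b c s cs => T E a b c s cs.
rewrite -[LHS]scale1r -cs; apply/rowP => m; rewrite !mxE; ring.
Qed.

Lemma dot_curl_rest v w z :
  (forall i, (i < p)%N -> dot (tau i v) z = 0 /\ z 0 (iu i) = 0) ->
  dot (curl_rest v w) z = 0.
Proof.
move=> zP; rewrite dot_suml big1 // => i _; have [tz uz] := zP i (ltn_ord i).
by rewrite dotZl dotDl dotNl !dotZl tz dot_el uz !mulr0 subr0 mulr0.
Qed.

Lemma dot_curl_rest_normal v w : dot (curl_rest v w) (nu v) = 0.
Proof.
apply: dot_curl_rest => i ip; split; first by apply: dot_tangent_normal; lia.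
by rewrite -dot_el dot_angle_normal //; lia.
Qed.

Lemma dot_curl_rest_rotating v w : dot (curl_rest v w) (q v) = 0.
Proof.
apply: dot_curl_rest => i ip; have ip' := ltnW ip; split.
  rewrite dotC dot_rotating_l tangent_angle // [dot (tau p v) _]dotC.
  by rewrite sphere_tangent_orth // !mulr0 subr0.
rewrite -dot_er dot_rotating_l dot_er tangent_angle // mxE.
by rewrite eqxx angle_index_eq // (gtn_eqF ip) !mulr0 subr0.
Qed.

Lemma dot_curl_rest_rotating' v w : dot (curl_rest v w) (q' v) = 0.
Proof.
apply: dot_curl_rest => i ip; have ip' := ltnW ip; split.
  rewrite dotC dot_rotating'_l tangent_angle // [dot (tau p v) _]dotC.
  by rewrite sphere_tangent_orth // !mulr0 subr0.
rewrite -dot_er dot_rotating'_l dot_er tangent_angle // mxE.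
by rewrite eqxx angle_index_eq // (gtn_eqF ip) !mulr0 subr0.
Qed.

(** Pairing with [tau i] and with ['e_(iu i)] isolates one coefficient each by orthogonality, and
    [immersion_coef_ge2] allows division by [r_i]. *)
Lemma curl_rest_eq0 v w : curl_rest v w = 0 ->
  forall i, (i < p)%N -> w 0 (iu i) = 0 /\ dot (tau i v) w = 0.
Proof.
move=> c0 i ip; have ip' := ltnW ip.
have c_neq0 : coef i v != 0.
  have := @immersion_coef_ge2 R p i p.+1 v (leq_trans ip (leqnSn p)).
  by apply: contraTneq => ->; rewrite -ltNge.
have H z : dot (curl_rest v w) z = 0 by rewrite c0 dot0l.
have dotz z : (forall j, (j < p)%N -> j != i -> dot (tau j v) z = 0 /\ z 0 (iu j) = 0) ->
    coef i v * (w 0 (iu i) * dot (tau i v) z - dot (tau i v) w * z 0 (iu i)) = 0.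
  move=> zP; rewrite -[RHS](H z) dot_suml (bigD1 (Ordinal ip)) //=.
  rewrite big1 ?addr0; first by rewrite [in RHS]dotZl [in RHS]dotDl dotNl !dotZl dot_el.
  move=> j ji; have [tz uz] := zP j (ltn_ord j) ji.
  by rewrite dotZl dotDl dotNl !dotZl tz dot_el uz !mulr0 subr0 mulr0.
split.
  have := dotz (tau i v); rewrite sphere_tangent_unit // tangent_angle //.
  rewrite mulr1 mulr0 subr0 => h; have : coef i v * w 0 (iu i) = 0.
    apply: h => j jp ji; rewrite tangent_angle //; last by lia.
    split=> //; have [ij|ij] := ltnP j i; first by rewrite sphere_tangent_orth.
    by rewrite dotC sphere_tangent_orth //; lia.
  by move/eqP; rewrite mulf_eq0 (negbTE c_neq0) => /eqP.
have := dotz 'e_(iu i); rewrite dot_er tangent_angle // mxE !eqxx mulr0 sub0r mulr1.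
move=> h; have : coef i v * - dot (tau i v) w = 0.
  apply: h => j jp ji; rewrite dot_er tangent_angle //; last by lia.
  by split=> //; rewrite mxE eqxx angle_index_eq //; [rewrite (negbTE ji)|lia].
by move/eqP; rewrite mulf_eq0 (negbTE c_neq0) oppr_eq0 => /eqP.
Qed.

Lemma reduced_inverse_form v (y : 'rV[R]_N) :
  (y *m reduced_inverse v *m y^T) 0 0 =
  dot y y + 3^-1 * (dot y (nu v) ^+ 2 + dot y (q v) ^+ 2)
  - 4 / 3 * (dot y (nu v) * dot y (q v)).
Proof.
exact: outer_inverse_form.
Qed.

Lemma twisted_inverse_form v (y : 'rV[R]_N) : y 0 ord0 = 0 ->
  (y *m Ginv v *m y^T) 0 0 = (y *m reduced_inverse v *m y^T) 0 0.
Proof.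
move=> y0; have yu : y *m unshear v = y.
  rewrite /unshear mulmxBr mulmx1 mulmx_outer (_ : dot y e0 = 0) ?scale0r ?subr0 //.
  by rewrite dot_er.
by rewrite /twisted_inverse !mulmxA yu -mulmxA -trmx_mul yu.
Qed.

Lemma line_hessian_form v w :
  (w *m line_hessian G v *m w^T) 0 0 = - (dot (nu v) w * dot (q v) w).
Proof.
have -> : line_hessian G v = - 2^-1 *: ((nu v)^T *m q v + (q v)^T *m nu v).
  apply/matrixP => k l; rewrite line_hessian_twisted.
  have outer (a b : 'rV[R]_N) : (a^T *m b) k l = a 0 k * b 0 l.
    by rewrite mxE big_ord1 mxE.
  have adE (A B : 'M[R]_N) : (A + B) k l = A k l + B k l by rewrite mxE.
  have scE c (A : 'M[R]_N) : (c *: A) k l = c * A k l by rewrite mxE.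
  by rewrite scE adE !outer.
rewrite -scalemxAr mulmxDr !mulmx_outer -scalemxAl -/(dot _ w).
have scE c (A : 'M[R]_1) : (c *: A) 0 0 = c * A 0 0 by rewrite mxE.
rewrite scE -/(dot _ w) dotDl !dotZl (dotC w (nu v)) (dotC w (q v)); by field.
Qed.

(** The Hessian gives [n A / 2], cancelled by the cross term of [(n / 4 - A)^2], whose remaining
    squares are [n^2 / 16] and [A^2]. The components [C / 4] and [C] along [nu] and [q] give
    [4/3 (1/16 + 1 - 1/4) C^2 = 13/12 C^2]. *)
Lemma mixed_curvature_form v w :
  - 2^-1 * (w *m line_hessian G v *m w^T) 0 0 +
    (line_second_form G v w *m Ginv v *m (line_second_form G v w)^T) 0 0 =
  16^-1 * dot (nu v) w ^+ 2 + dot (q v) w ^+ 2 + 13 / 12 * dot (q' v) w ^+ 2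
  + 4^-1 * dot (curl_rest v w) (curl_rest v w).
Proof.
set n := dot (nu v) w; set A := dot (q v) w; set C := dot (q' v) w.
set z := curl_rest v w.
have zn : dot z (nu v) = 0 by exact: dot_curl_rest_normal.
have zq : dot z (q v) = 0 by exact: dot_curl_rest_rotating.
have zq' : dot z (q' v) = 0 by exact: dot_curl_rest_rotating'.
have nn := unit_normal_unit v; have qq := rotating_unit v.
have qq' := dot_rotating_rotating' v; have q'q' := rotating'_unit v.
have nq := dot_normal_rotating v; have nq' := dot_normal_rotating' v.
have xiE : line_second_form G v w =
    (C / 4) *: nu v + C *: q v + (n / 4 - A) *: q' v + 2^-1 *: z.
  have combine (a b c d : 'rV[R]_N) :
      2^-1 *: (2^-1 *: (n *: c + C *: a) + (2 *: (C *: b - A *: c) + d)) =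
      (C / 4) *: a + C *: b + (n / 4 - A) *: c + 2^-1 *: d.
    by apply/rowP => m; rewrite !mxE; field.
  by rewrite line_second_form_twisted curlE; exact: combine.
(* [D_w T] is orthogonal to the unit field [T], so the shear drops out of the inverse metric on this
   covector. *)
have xi0 : line_second_form G v w 0 ord0 = 0.
  rewrite xiE; have adE (a b : 'rV[R]_N) : (a + b) 0 ord0 = a 0 ord0 + b 0 ord0.
    by rewrite mxE.
  have scE c (a : 'rV[R]_N) : (c *: a) 0 ord0 = c * a 0 ord0 by rewrite mxE.
  have n0 : nu v 0 ord0 = 0 by exact: unit_normal_small.
  have z0 : z 0 ord0 = 0.
    rewrite /z /curl_rest summxE big1 // => i _; have ip := ltnW (ltn_ord i).
    have NE (a : 'rV[R]_N) : (- a) 0 ord0 = - a 0 ord0 by rewrite mxE.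
    rewrite scE adE NE !scE sphere_tangent_space // mxE eqxx eq_sym.
    by rewrite angle_index_neq0 // !mulr0 subr0 mulr0.
  by rewrite adE adE adE 4!scE n0 rotating0 rotating'0 z0 !mulr0 !addr0.
have zz c d : dot (c *: z) (d *: z) = c * d * dot z z by rewrite dotZl dotZr mulrA.
have cz y c : dot z y = 0 -> dot (c *: z) y = 0 by move=> h; rewrite dotZl h mulr0.
rewrite twisted_inverse_form // reduced_inverse_form.
rewrite (outer_inverse_orthonormal nn qq q'q' nq nq' qq' (cz _ _ zn) (cz _ _ zq)
  (cz _ _ zq') xiE).
rewrite zz line_hessian_form -/n -/A; by field.
Qed.

End TwistedMetricMixedCurvature.

(** * Mixed curvature and leaves of the twisted torus *)

Lemma inner_sym (R : realType) n (G : 'rV[R]_n -> 'M[R]_n) x v w :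
  (G x)^T = G x -> inner G x v w = inner G x w v.
Proof.
move=> sG; rewrite /inner -[LHS](trace_mx11 (v *m G x *m w^T)) -mxtrace_tr.
by rewrite trace_mx11 !trmx_mul trmxK sG mulmxA.
Qed.

Section TwistedTorus.
Context {R : realType} (p : nat).
Local Notation N := (p.+1.*2.+2).
Implicit Types (v w x : 'rV[R]_N) (i j : nat) (k l m : 'I_N) (t : R).
Local Notation iu := (@angle_index p).
Local Notation ix := (@space_index p).
Local Notation tau := (@sphere_tangent R p).
Local Notation e0 := ('e_(ord0 : 'I_N) : 'rV[R]_N).
Local Notation nu := (@unit_normal R p).
Local Notation beta := (@connection R p).
Local Notation q := (@rotating R p).
Local Notation q' := (@rotating' R p).
Local Notation G := (@twisted_metric R p).

Definition twisted_torus : riemannian_metric (@torus R N) :=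
  torus_metric (@elementary_twisted_metric R p) (@twisted_metric_sym R p)
    (@twisted_metric_pos R p) (@twisted_metric_period R p).

Local Notation leaves := (@torus_foliation R N 1).

Lemma twisted_christoffel00 k x : christoffel G k ord0 ord0 x = 0.
Proof.
exact: (christoffel00 (@twisted_metric_invmx R p) (@twisted_metric00 R p) (@twisted_metric0_line R p)).
Qed.

Lemma sum_twisted_metric0 v w :
  \sum_l G v ord0 l * w 0 l = w 0 ord0 + dot (beta v) w.
Proof.
under eq_bigr do rewrite twisted_metric0 mulrDl.
rewrite big_split /= -dotE (bigD1 ord0) //= mul1r big1 ?addr0 // => l /negbTE ->.
by rewrite mul0r.
Qed.

Lemma inner_twisted_line v w c :
  inner G v w (c *: e0) = c * (w 0 ord0 + dot (beta v) w).
Proof. by rewrite (inner_line (@twisted_metric_sym R p)) sum_twisted_metric0. Qed.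

(** The sum of squares is blind to the leaf direction. Its vanishing removes all angle and space
    components of [w], leaving a multiple of [e0], and horizontality, the first hypothesis, removes
    that one. *)
Lemma mixed_form_eq0 v w : w 0 ord0 + dot (beta v) w = 0 ->
  dot (nu v) w = 0 -> dot (q v) w = 0 -> dot (q' v) w = 0 ->
  curl_rest v w = 0 -> w = 0.
Proof.
move=> bw nw qw q'w /curl_rest_eq0 rest.
set a := w 0 (iu p); set b := dot (tau p v) w.
have cs : cos (v 0 ord0) ^+ 2 + sin (v 0 ord0) ^+ 2 = 1 by exact: cos2Dsin2.
move: qw q'w; rewrite dot_rotating_l dot_rotating'_l -/a -/b => qw q'w.
have a0 : a = 0.
  rewrite -[a]mul1r -cs (_ : _ * a = cos (v 0 ord0) * (cos (v 0 ord0) * a - sin (v 0 ord0) * b)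
    - sin (v 0 ord0) * (- sin (v 0 ord0) * a - cos (v 0 ord0) * b)); last by ring.
  by rewrite qw q'w !mulr0 subr0.
have b0 : b = 0.
  rewrite -[b]mul1r -cs (_ : _ * b = - sin (v 0 ord0) * (cos (v 0 ord0) * a - sin (v 0 ord0) * b)
    - cos (v 0 ord0) * (- sin (v 0 ord0) * a - cos (v 0 ord0) * b)); last by ring.
  by rewrite qw q'w !mulr0 subr0.
have angles i : (i <= p)%N -> w 0 (iu i) = 0 /\ dot (tau i v) w = 0.
  by rewrite leq_eqVlt => /orP[/eqP->|/rest].
have space i : (i <= p.+1)%N -> w 0 (ix i) = 0.
  apply: (@sphere_frame_complete R p p.+1 v w) => // j; rewrite ltnS => jp.
  by have [] := angles j jp.
have wE : w = w 0 ord0 *: e0.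
  apply/rowP => k; rewrite [RHS]mxE [X in _ = _ * X]mxE /=.
  have [->|[i ip ->]|[i ip ->]] := index_cases k.
  - by rewrite eqxx mulr1.
  - by have [-> _] := angles i ip; rewrite angle_index_neq0 // mulr0.
  - rewrite space // (_ : (ix i == ord0) = false) ?mulr0 //.
    by rewrite -val_eqE /= val_space_index.
have w0 : w 0 ord0 = 0.
  by move: bw; rewrite {2}wE dotZr dot_connection_e0 mulr0 addr0.
by rewrite wE w0 scale0r.
Qed.

Lemma twisted_mixed_pos v w : w 0 ord0 + dot (beta v) w = 0 -> w != 0 ->
  0 < - 2^-1 * (w *m line_hessian G v *m w^T) 0 0 +
    (line_second_form G v w *m twisted_inverse v *m (line_second_form G v w)^T) 0 0.
Proof.
move=> bw; rewrite mixed_curvature_form; apply: contraNT; rewrite -leNgt => le0.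
have n0 := sqr_ge0 (dot (nu v) w); have q0 := sqr_ge0 (dot (q v) w).
have q'0 := sqr_ge0 (dot (q' v) w); have z0 := dot_ge0 (curl_rest v w).
apply/eqP; apply: mixed_form_eq0 bw _ _ _ _; apply/eqP;
  rewrite -?(dot_eq0 (curl_rest v w)) -?[dot (nu v) w == 0]sqrf_eq0
    -?[dot (q v) w == 0]sqrf_eq0 -?[dot (q' v) w == 0]sqrf_eq0 eq_le; apply/andP; split => //; lra.
Qed.

Lemma tangent_lineP (c : chart R N (@torus R N)) x v : atlas c -> ccod c x ->
  tangent leaves c x v <-> v = v 0 ord0 *: e0.
Proof.
move=> ac cx; rewrite (torus_tangentP 1 v ac cx); split=> [v0|-> j j1].
  apply/rowP => k; rewrite [RHS]mxE [X in _ = _ * X]mxE /=.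
  case: eqP => [->|/eqP k0]; first by rewrite mulr1.
  by rewrite v0 ?mulr0 // lt0n.
by rewrite mxE [X in _ * X]mxE /= -val_eqE /= gtn_eqF // mulr0.
Qed.

Lemma tangent_e0 (c : chart R N (@torus R N)) x : atlas c -> ccod c x ->
  tangent leaves c x e0.
Proof. by move=> ac cx; apply/tangent_lineP => //; rewrite mxE !eqxx scale1r. Qed.

Lemma twisted_torus_Kmix : Kmix_pos leaves twisted_torus.
Proof.
move=> c x v w ac cx /(tangent_lineP _ ac cx) vE nw v0 w0.
have := nw _ (tangent_e0 ac cx).
rewrite -[e0]scale1r inner_twisted_line mul1r => bw.
have vw : inner G x v w = 0.
  rewrite inner_sym; last exact: twisted_metric_sym.
  by rewrite vE inner_twisted_line bw mulr0.
have s0 : v 0 ord0 != 0 by apply: contraNneq v0 => s0; rewrite vE s0 scale0r.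
rewrite /sectional_curvature /= vw expr0n subr0 divr_gt0 //; last first.
  by apply: mulr_gt0; apply: twisted_metric_pos.
rewrite vE (inner_curvature (@elementary_twisted_metric R p)
  (@elementary_twisted_inverse R p) (@twisted_metric_sym R p)
  (@twisted_metric_invmx R p) (@twisted_metricV R p)
  (@twisted_metric00 R p) (@twisted_metric0_line R p)).
by rewrite mulr_gt0 ?exprn_even_gt0 //; apply: twisted_mixed_pos.
Qed.

Lemma twisted_torus_geodesic : totally_geodesic leaves twisted_torus.
Proof.
move=> c V X Y ac oV Vc sX sY XY x Vx; have cx := Vc x Vx.
have X0 y k : V y -> k != ord0 -> X y 0 k = 0.
  move=> Vy k0; have [/(tangent_lineP _ ac (Vc y Vy)) -> _] := XY y Vy.
  by rewrite mxE [X in _ * X]mxE (negbTE k0) andbF mulr0.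
have Y0 y k : V y -> k != ord0 -> Y y 0 k = 0.
  move=> Vy k0; have [_ /(tangent_lineP _ ac (Vc y Vy)) ->] := XY y Vy.
  by rewrite mxE [X in _ * X]mxE (negbTE k0) andbF mulr0.
apply/(torus_tangentP 1 _ ac cx) => j j1.
have j0 : j != ord0 by rewrite -lt0n.
rewrite mxE big1 ?add0r => [|k _].
  rewrite big1 // => k _; rewrite big1 // => l _.
  have [->|k0] := eqVneq k ord0; last by rewrite X0 // mulr0 mul0r.
  have [->|l0] := eqVneq l ord0; last by rewrite Y0 // mulr0.
  by rewrite twisted_christoffel00 !mul0r.
(* The components of [Y] transverse to the leaves vanish on the whole open set [V], hence so do
   their derivatives. *)
rewrite (_ : partial k _ x = 0) ?mulr0 // -[RHS](partial_cst (0 : R) x k).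
apply: partial_near; have : nbhs x V by apply: open_nbhs_nbhs.
by apply: filterS => y Vy; rewrite Y0.
Qed.

End TwistedTorus.

(** * Failure of the bundle-like property *)

Section Submersions.
Context {R : realType}.

(** Both arguments lie in [[0, 2]], inside [[0, pi]], where cosine is injective. The base point of
    the final contradiction is placed at leaf coordinate 1 for this reason. *)
Lemma cos1D_neq (s : R) : 0 < s -> s < 1 -> cos (1 + s) <> cos 1.
Proof.
move=> s0 s1 cs; have pi2 := @pi_ge2 R; have : 1 + s = 1; last by lra.
by apply: cos_inj cs; rewrite in_itv /=; apply/andP; split; lra.
Qed.

Lemma differentiable_rowP m n (f : 'rV[R]_m -> 'rV[R]_n) x :
  (forall j, differentiable (fun y => f y 0 j) x) -> differentiable f x.
Proof.
move=> df; rewrite (_ : f = \sum_j (fun y => f y 0 j *: ('e_j : 'rV[R]_n))).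
  by apply: differentiable_sum => j; apply: differentiableZl.
by apply/funext => y; rewrite fct_sumE; exact: row_sum_delta.
Qed.

Lemma derive_translate (V W : normedModType R) (f : V -> W) a x v :
  'D_v (fun y => f (y + a)) x = 'D_v f (x + a).
Proof.
rewrite /derive (_ : (fun h => h^-1 *: (_ - f (x + a))) =
  (fun h => h^-1 *: ((f \o shift (x + a)) (h *: v) - f (x + a)))) //.
by apply/funext => h /=; rewrite addrA.
Qed.

Lemma derive_near_invariant (V W : normedModType R) (f : V -> W) x v :
  (\forall h \near (0 : R), f (h *: v + x) = f x) -> 'D_v f x = 0.
Proof.
move=> fx; rewrite /derive; apply/lim_near_cst => //=; near=> h.
rewrite (_ : f (h *: v + x) = f x) ?subrr ?scaler0 //.
by near: h; exact: nbhs_dnbhs.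
Unshelve. all: by end_near. Qed.

Lemma mulmx_row_inj m n (A B : 'M[R]_(m, n)) :
  (forall v : 'rV[R]_m, v *m A = v *m B) -> A = B.
Proof. by move=> AB; apply/row_matrixP => i; rewrite !rowE AB. Qed.

Lemma jacobian_line_invariant n m (F : 'rV[R]_n.+1 -> 'rV[R]_m) x s :
  differentiable F x -> differentiable F (line x s) ->
  (\forall y \near line x s, F y = F (line y (- s))) ->
  jacobian F (line x s) = jacobian F x.
Proof.
move=> dx ds shift; apply: mulmx_row_inj => v.
apply: etrans (esym (deriveEjacobian _ ds)) _.
apply: etrans (deriveEjacobian _ dx).
apply: etrans (near_eq_derive _ shift) _.
apply: etrans (derive_translate F _ _ _) _.
have back : line x s + (- s) *: 'e_ord0 = x by rewrite scaleNr addrK.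
by rewrite back.
Qed.

Lemma jacobian_line_kernel n m (F : 'rV[R]_n.+1 -> 'rV[R]_m) x :
  differentiable F x -> (\forall t \near (0 : R), F (line x t) = F x) ->
  ('e_ord0 : 'rV[R]_n.+1) *m jacobian F x = 0.
Proof.
move=> dx Fx; apply: etrans (esym (deriveEjacobian _ dx)) _.
apply: derive_near_invariant.
by apply: filterS Fx => t <-; rewrite /line addrC.
Qed.

Lemma kernel_line m n (J : 'M[R]_(m, n)) (e w : 'rV[R]_m) :
  row_full J -> m = n.+1 -> e != 0 -> e *m J = 0 -> w *m J = 0 ->
  exists a, w = a *: e.
Proof.
move=> fJ mn e0 eJ wJ; apply/sub_rVP.
have ek : (e <= kermx J)%MS by apply/sub_kermxP.
have wk : (w <= kermx J)%MS by apply/sub_kermxP.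
apply: submx_trans wk _; rewrite -(geq_leqif (mxrank_leqif_sup ek)).
by rewrite mxrank_ker (eqP fJ) rank_rV e0 mn subSnn.
Qed.

End Submersions.

Section NotBundleLike.
Context {R : realType} (p : nat).
Local Notation N := (p.+1.*2.+2).
Implicit Types (v w x y : 'rV[R]_N) (t s : R).
Local Notation iu := (@angle_index p).
Local Notation e0 := ('e_(ord0 : 'I_N) : 'rV[R]_N).
Local Notation nu := (@unit_normal R p).
Local Notation beta := (@connection R p).
Local Notation q := (@rotating R p).
Local Notation G := (@twisted_metric R p).
Local Notation leaves := (@torus_foliation R N 1).

(* The horizontal lift of a base vector whose length varies along the fibres. *)
Definition stretched x : 'rV[R]_N :=
  nu x + 'e_(iu p) - dot (beta x) (nu x + 'e_(iu p)) *: e0.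

Lemma stretched_line x t : stretched (line x t) = stretched x.
Proof.
by rewrite /stretched /unit_normal /connection sphere_pt_line // immersion_line.
Qed.

Lemma stretched_horizontal x w c : w = c *: e0 -> inner G x (stretched x) w = 0.
Proof.
move=> ->; rewrite inner_twisted_line /stretched.
have u0 : (nu x + 'e_(iu p)) 0 ord0 = 0.
  rewrite mxE unit_normal_small // add0r mxE eqxx eq_sym.
  by rewrite angle_index_neq0.
move: (nu x + 'e_(iu p)) u0 => z z0.
rewrite dotDr dotNr dotZr dot_connection_e0 mulr0 subr0.
have -> : (z - dot (beta x) z *: e0) 0 ord0 = - dot (beta x) z.
  rewrite mxE z0 add0r mxE [X in - X]mxE.
  by rewrite [e0 0 ord0]mxE !eqxx mulr1.
by rewrite addNr mulr0.
Qed.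

Lemma stretched_norm x : inner G x (stretched x) (stretched x) = 2 + cos (x 0 ord0).
Proof.
have nE : dot (nu x) 'e_(iu p) = 0 by rewrite dotC dot_angle_normal.
have qE : dot (q x) 'e_(iu p) = cos (x 0 ord0) by rewrite dot_er rotating_angle.
have qn : dot (q x) (nu x) = 0 by rewrite dotC dot_normal_rotating.
have n0 : dot (nu x) e0 = 0 by rewrite dot_er unit_normal_small.
have q0 : dot (q x) e0 = 0 by rewrite dot_er rotating0.
have ee : dot ('e_(iu p) : 'rV[R]_N) 'e_(iu p) = 1.
  by rewrite dot_angle_angle // eqxx.
rewrite inner_twisted; set s := stretched x.
have bs : dot (beta x) s = dot (beta x) (nu x + 'e_(iu p)) - dot (beta x) (nu x + 'e_(iu p)) * 0.
  by rewrite /s /stretched dotDr dotNr dotZr dot_connection_e0.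
have -> : s + dot (beta x) s *: e0 = nu x + 'e_(iu p).
  by rewrite bs mulr0 subr0 /s /stretched subrK.
have -> : dot (nu x) s = 1.
  rewrite /s /stretched dotDr dotNr dotZr n0 mulr0 subr0 dotDr nE.
  by rewrite unit_normal_unit addr0.
have -> : dot (q x) s = cos (x 0 ord0).
  by rewrite /s /stretched dotDr dotNr dotZr q0 mulr0 subr0 dotDr qE qn add0r.
have sq (a b : 'rV[R]_N) : dot (a + b) (a + b) = dot a a + dot b b + 2 * dot a b.
  by rewrite dotDl !dotDr (dotC b a); ring.
by rewrite sq nE ee unit_normal_unit mulr0 addr0 mul1r.
Qed.

(** A short leaf segment is connected and stays in [U], hence lies in one component of the leaf
    within [U], which is a fibre of [f]. The radius is halved so that both the point and its
    displacement keep the segment in [U]. *)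
Lemma near_fiber_constant (T : Type) (U : set (@torus R N)) (f : @torus R N -> T) x :
  open U -> U (proj x) ->
  (forall y : @torus R N, U y -> U `&` f @^-1` [set f y] =
    connected_component (U `&` leaf leaves y) y) ->
  exists2 e : R, 0 < e & forall y s, (forall k, `|x 0 k - y 0 k| < e) -> `|s| < e ->
    U (proj y) /\ f (proj (line y s)) = f (proj y).
Proof.
move=> oU Ux Uf; have : \forall y \near x, U (proj y).
  by apply: (@proj_continuous R N x); apply: open_nbhs_nbhs.
move=> /nbhs_rowP[e e0 eU]; exists (e / 2); first by rewrite divr_gt0.
move=> y s ye se; have e2 : e / 2 + e / 2 = e by field.
have Uline t : `|t| <= `|s| -> U (proj (line y t)).
  move=> ts; apply: eU => k; rewrite lineE opprD addrA.
  apply: le_lt_trans (ler_normB _ _) _; rewrite -e2 ltrD //.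
  apply: le_lt_trans (le_lt_trans ts se); rewrite normrM.
  by case: eqP => _; rewrite ?normr1 ?mulr1 // normr0 mulr0.
have Uy : U (proj y) by rewrite -(line0 y); apply: Uline; rewrite normr0.
split=> //; pose S := (fun t => proj (line y t)) @` `[- `|s|, `|s| ]%classic.
have Sin t : `|t| <= `|s| -> S (proj (line y t)).
  by move=> ts; exists t => //=; rewrite in_itv /= -ler_norml.
suff : (U `&` f @^-1` [set f (proj y)]) (proj (line y s)) by case.
rewrite Uf //; apply: (@connected_component_max _ _ S).
- by rewrite -[y in X in S X]line0; apply: Sin; rewrite normr0.
- move=> _ [t + <-]; rewrite /= in_itv /= -ler_norml => ts; split; first exact: Uline.
  by rewrite torus_leaf; exists t.
- apply: connected_continuous_connected; first exact: segment_connected.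
  apply: continuous_subspaceT => t.
  by apply: continuous_comp; [exact: line_continuous|exact: proj_continuous].
- exact: Sin.
Qed.

Lemma twisted_torus_not_bundle_like : ~ bundle_like (@twisted_torus R p) leaves.
Proof.
have [x x0] : exists x : 'rV[R]_N, x 0 ord0 = 1.
  by exists (line 0 1); rewrite lineE mxE eqxx add0r mulr1.
move=> /(_ (proj x))[U [Q [h [f [oU Ux [[cf sf] subf] Uf]]]]].
have [d ad dfx] := atlas_cover (f (proj x)).
pose c := torus_chart x; have ac : atlas (c : chart R N (@torus R N)) by exists x.
have [e1 e1_gt0 fib] := near_fiber_constant oU Ux Uf.
have : \forall y \near x, local_dom U f c d y.
  have H1 : \forall y \near x, cell x y.
    by apply: open_nbhs_nbhs; split; [exact: open_box|exact: cell_center].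
  have H2 : \forall y \near x, U (proj y).
    by apply: (@proj_continuous R N x); apply: open_nbhs_nbhs.
  have H3 : \forall y \near x, cdom d (f (proj y)).
    have : nbhs (f (proj x)) (cdom d) by apply: open_nbhs_nbhs; split => //; exact: cdom_open.
    move=> dn; exact: (@proj_continuous R N x _ (cf _ Ux _ dn)).
  by apply: filterS3 H1 H2 H3.
move=> /nbhs_rowP[e2 e2_gt0 dom].
have [s [s_gt0 s_lt1 s_lte1 s_lte2]] :
    exists s : R, [/\ 0 < s, s < 1, s < e1 & s < e2].
  exists (Num.min 1 (Num.min e1 e2) / 2).
  have : 0 < Num.min 1 (Num.min e1 e2) by rewrite !lt_min ltr01 e1_gt0.
  have : Num.min 1 (Num.min e1 e2) <= 1 by rewrite ge_min lexx.
  have : Num.min 1 (Num.min e1 e2) <= e1 by rewrite !ge_min lexx orbT.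
  have : Num.min 1 (Num.min e1 e2) <= e2 by rewrite !ge_min lexx !orbT.
  by move=> *; split; lra.
pose F := local_expr f c d.
have normxx k : `|x 0 k - x 0 k| < s by rewrite subrr normr0.
have normxs k : `|x 0 k - line x s 0 k| <= s.
  rewrite lineE opprD addrA subrr add0r normrN normrM.
  by case: eqP => _; rewrite ?normr1 ?normr0 ?mulr1 ?mulr0 ?gtr0_norm // ltW.
have Fdiff y : (forall k, `|x 0 k - y 0 k| < e2) -> differentiable F y.
  move=> yx; apply: differentiable_rowP => j.
  have [dF _] := sf c d ac ad j 1%N; apply: dF; exact: dom.
have near_e1 y : (forall k, `|x 0 k - y 0 k| < e1) ->
    \forall z \near y, forall k, `|x 0 k - (z : 'rV[R]_N) 0 k| < e1.
  move=> yx.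
  have : nbhs y (box (x - const_mx e1) (x + const_mx e1)).
    apply: open_nbhs_nbhs; split; first exact: open_box.
    by move=> k; have := yx k; rewrite !mxE ltr_norml => /andP[? ?]; apply/andP; split; lra.
  apply: filterS => z xz k; have := xz k; rewrite !mxE ltr_norml => /andP[? ?].
  by apply/andP; split; lra.
have Fline y t : (forall k, `|x 0 k - y 0 k| < e1) -> `|t| < e1 ->
    F (line y t) = F y.
  by move=> yx te; have [_ fy] := fib y t yx te; rewrite /F /local_expr /= fy.
have xs1 k : `|x 0 k - line x s 0 k| < e1 by exact: le_lt_trans (normxs k) s_lte1.
have xs2 k : `|x 0 k - line x s 0 k| < e2 by exact: le_lt_trans (normxs k) s_lte2.
have xx1 k : `|x 0 k - x 0 k| < e1 by exact: lt_trans (normxx k) s_lte1.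
have xx2 k : `|x 0 k - x 0 k| < e2 by exact: lt_trans (normxx k) s_lte2.
have se : `|s| < e1 by rewrite gtr0_norm.
have Js : jacobian F (line x s) = jacobian F x.
  apply: jacobian_line_invariant; [exact: Fdiff|exact: Fdiff|].
  by apply: filterS (near_e1 _ xs1) => y yx; rewrite Fline // normrN.
have Fx0 : \forall t \near (0 : R), F (line x t) = F x.
  have t0 : \forall t \near (0 : R), `|t| < e1 by exact: nbhs0_lt.
  by apply: filterS t0 => t; exact: (Fline x t xx1).
have J0 := jacobian_line_kernel (Fdiff _ xx2) Fx0.
have e0_neq0 : e0 != 0.
  by apply/eqP => /rowP/(_ ord0)/eqP; rewrite !mxE !eqxx oner_eq0.
(* Full rank leaves a kernel of dimension one, namely the leaf direction, so orthogonality to [e0]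
   is horizontality for the submersion. *)
have horizontal y (J : 'M[R]_(N, N - 1)) : row_full J -> e0 *m J = 0 ->
    forall w, w *m J = 0 -> inner G y (stretched y) w = 0.
  move=> fJ eJ w wJ; have [|a ->] := kernel_line fJ _ e0_neq0 eJ wJ.
    by rewrite subn1.
  exact: stretched_horizontal.
have [fJx Ex] := subf c d x ac ad (dom x xx2).
have [fJs Es] := subf c d (line x s) ac ad (dom _ xs2).
have J0s : e0 *m jacobian F (line x s) = 0 by rewrite Js.
have Exx := Ex _ _ (horizontal x _ fJx J0) (horizontal x _ fJx J0).
have Ess := Es _ _ (horizontal (line x s) _ fJs J0s) (horizontal (line x s) _ fJs J0s).
(* The two points have the same image, the same Jacobian and the same vector [stretched], so a
   Riemannian submersion gives that vector equal lengths at both. By [stretched_norm] these squared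
   lengths are [2 + cos (1 + s)] and [2 + cos 1]. *)
have : inner G (line x s) (stretched (line x s)) (stretched (line x s)) =
    inner G x (stretched x) (stretched x).
  apply: etrans (esym Ess) (etrans _ Exx).
  by rewrite -/F Js stretched_line (Fline x s xx1 se).
rewrite !stretched_norm lineE eqxx mulr1 x0 => /addrI cs.
exact: cos1D_neq s_gt0 s_lt1 cs.
Qed.

End NotBundleLike.

Theorem theorem1p1 (R : realType) (N : nat) (hN : (4 <= N)%N)
    (hNeven : ~~ odd N) :
  exists (M : smooth_manifold R N) (g : riemannian_metric M)
         (F : foliation M 1),
    [/\ closed_manifold M,
        totally_geodesic F g,
        Kmix_pos F g,
        (forall x : M, closed_geodesic g (leaf F x)) &
        (exists (B : smooth_manifold R N.-1) (pi : M -> B),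
           circle_fibration pi /\
           (forall x : M, leaf F x = pi @^-1` [set pi x])) /\
        ~ bundle_like g F].
Proof.
have [p NE] : exists p, N = p.+1.*2.+2.
  (* The overview's [N = 2m + 2] with [m = p.+1]; the smallest case [N = 4] is [p = 0]. *)
  by exists (N./2 - 2)%N; move: (odd_double_half N); rewrite (negbTE hNeven); lia.
rewrite {N hN hNeven}NE.
exists (@torus R _), (@twisted_torus R p), (@torus_foliation R _ 1); split.
- exact: torus_compact.
- exact: twisted_torus_geodesic.
- exact: twisted_torus_Kmix.
- by move=> x; apply: torus_closed_geodesic; exact: twisted_christoffel00.
- split; last exact: twisted_torus_not_bundle_like.
  exists (@torus R _), (@torus_fibration R _); split.
    exact: torus_circle_fibration.
  exact: torus_leaf_fiber.
Qed.
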